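(* Let $\lambda$ be a singular cardinal and let $\theta\le\lambda$ be an infinite cardinal. Then any one of the following hypotheses implies that $\mathrm{U}(\lambda^+,\lambda^+,\theta,\mathrm{cf}(\lambda))$ holds: (1) $2^\lambda=\lambda^+$; (2) $\mathrm{Refl}({<}\mathrm{cf}(\lambda),\lambda^+)$ fails; (3) there is a closed witness to $\mathrm{U}(\lambda^+,2,\theta,2)$; (4) $\mathrm{cf}(\theta)<\mathrm{cf}(\lambda)$ and $2^{\mathrm{cf}(\lambda)}<\lambda$; (5) $\mathrm{cf}(\theta)=\mathrm{cf}(\lambda)$; (6) $\mathrm{cf}(\theta)=\omega$.
   Context: For a set $X$ and a cardinal $\nu$, $[X]^\nu$ is the set of subsets of $X$ of size $\nu$. For sets of ordinals $a,b$, $a<b$ means $\alpha<\beta$ for all $\alpha\in a,\beta\in b$. For a collection $\mathcal B$ of sets of ordinals, $(a,b)\in[\mathcal B]^2$ means that $a,b$ are distinct elements of $\mathcal B$ with $a<b$. For $c:[\kappa]^2\to\theta$ and $\alpha<\beta<\kappa$, $c(\alpha,\beta)$ denotes $c(\{\alpha,\beta\})$, and for $a<b$, $c[a\times b]=\{c(\alpha,\beta)\mid\alpha\in a,\beta\in b\}$. For a regular uncountable cardinal $\kappa$ and cardinals $\mu,\theta,\chi\le\kappa$, a coloring $c:[\kappa]^2\to\theta$ witnesses $\mathrm{U}(\kappa,\mu,\theta,\chi)$ if for every $\chi'<\chi$, every family $\mathcal A\subseteq[\kappa]^{\chi'}$ consisting of $\kappa$-many pairwise disjoint sets, and every $i<\theta$,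 there exists $\mathcal B\in[\mathcal A]^\mu$ such that $\min(c[a\times b])>i$ for all $(a,b)\in[\mathcal B]^2$. $\mathrm{U}(\kappa,\mu,\theta,\chi)$ asserts that such a witness exists. A coloring $c:[\kappa]^2\to\theta$ is closed if, for all $\beta<\kappa$ and $i\le\theta$, the set $D^c_{\le i}(\beta)=\{\alpha<\beta\mid c(\alpha,\beta)\le i\}$ contains every nonzero $\gamma<\beta$ with $\sup(D^c_{\le i}(\beta)\cap\gamma)=\gamma$. $\mathrm{Refl}({<}\nu,S)$, for $S\subseteq\kappa$, asserts that for every family $\mathcal S$ consisting of fewer than $\nu$-many stationary subsets of $S$, there is $\alpha<\kappa$ with $\mathrm{cf}(\alpha)>\omega$ such that $T\cap\alpha$ is stationary in $\alpha$ for every $T\in\mathcal S$. *)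

(* Defs.v *)
(* Ordinals are the elements of a well-ordered type [O] (a [bOrderType] whose
   [<=%O] satisfies [well_order], a hypothesis of the statements, not of the
   definitions below): [a : O] stands for the order type of [below a], and
   every initial segment of the ordinals arises in this way, so that
   quantifying over [O] amounts to working with all ordinals.  Cardinals are
   initial ordinals. *)
From mathcomp Require Import all_boot all_order.
From mathcomp Require Import boolp classical_sets functions cardinality.
From mathcomp Require Import wochoice.

Set Implicit Arguments.
Unset Strict Implicit.
Unset Printing Implicit Defensive.

Import Order.TTheory.

Local Open Scope classical_set_scope.
Local Open Scope card_scope.
Local Open Scope order_scope.

Definition card_lt (T U : Type) (A : set T) (B : set U) : Prop :=
  (A #<= B) /\ ~ (B #<= A).

Section Ordinals.
Context {d : Order.disp_t} {O : bOrderType d}.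
Implicit Types (a b x y al be ga ka la mu nu th ch : O) (A B C D S T : set O).

(* The von Neumann ordinal [a], as a set of ordinals. *)
Definition below a : set O := [set x | x < a].

Definition is_least A x : Prop := A x /\ lbound A x.

(* The minimum of a nonempty set of ordinals ([\bot] if the set is empty). *)
Definition least A : O := xget \bot (is_least A).

Definition is_cardinal a : Prop :=
  forall b, b < a -> ~ (below b #= below a).

Definition ord_of_nat (n : nat) : O := least [set a | below a #= `I_n].

Definition omega : O := least [set a | infinite_set (below a)].

(* [ka] is the cardinal successor of [la]; stated as a relation because [O]
   might stop before the successor of [la]. *)
Definition is_succ_cardinal la ka : Prop :=
  is_least [set a | card_lt (below la) (below a)] ka.

Definition cofinal_map b a (f : O -> O) : Prop :=
  (forall x, x < b -> f x < a) /\
  (forall y, y < a -> exists2 x, x < b & y <= f x).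

Definition cf a : O := least [set b | exists f : O -> O, cofinal_map b a f].

Definition singular la : Prop :=
  [/\ is_cardinal la, infinite_set (below la) & cf la < la].

Definition set_lt A B : Prop := forall x y, A x -> B y -> x < y.

(* A coloring [c : [ka]^2 -> th] is a binary function of which only the values
   [c al be] with [al < be < ka] are relevant. *)
Definition coloring ka th (c : O -> O -> O) : Prop :=
  forall al be, al < be -> be < ka -> c al be < th.

Definition U_witness ka mu th ch (c : O -> O -> O) : Prop :=
  coloring ka th c /\
  forall ch', is_cardinal ch' -> ch' < ch ->
  forall F : set (set O),
    (forall A, F A -> A `<=` below ka /\ (A #= below ch')) ->
    (F #= below ka) -> trivIset F id ->
  forall i, i < th ->
  exists G : set (set O),
    [/\ G `<=` F, G #= below mu &
        forall A B, G A -> G B -> A <> B -> set_lt A B ->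
          i < least [set c al be | al in A & be in B]].

Definition U_principle ka mu th ch : Prop :=
  exists c : O -> O -> O, U_witness ka mu th ch c.

(* The supremum of the empty set is [\bot], the ordinal zero. *)
Definition ord_sup A : O := supremum \bot A.

Definition Dle (c : O -> O -> O) (i be : O) : set O :=
  [set al | al < be /\ c al be <= i].

Definition closed_coloring ka th (c : O -> O -> O) : Prop :=
  forall be i, be < ka -> i <= th ->
  forall ga, ga != \bot -> ga < be ->
    ord_sup (Dle c i be `&` below ga) = ga -> Dle c i be ga.

(* Clubs and stationary sets, used for [al] of uncountable cofinality. *)
Definition club al C : Prop :=
  [/\ C `<=` below al,
      forall x, x < al -> exists2 y, C y & x < y &
      forall ga, ga != \bot -> ga < al -> ord_sup (C `&` below ga) = ga ->
        C ga].

Definition stationary al S : Prop :=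
  forall C, club al C -> (C `&` S) !=set0.

(* Refl(<nu, S), for S a subset of [ka]. *)
Definition Refl ka nu S : Prop :=
  forall F : set (set O),
    (forall T, F T -> T `<=` S /\ stationary ka T) ->
    card_lt F (below nu) ->
  exists al, [/\ al < ka, omega < cf al &
    forall T, F T -> stationary al (T `&` below al)].

End Ordinals.

(* Main.v *)
(* Let [ka] be the successor of the singular [la].  By Fodor's lemma
   ([hits_U_witness]) it suffices that, for a family of pairwise disjoint sets of
   size below [cf la] and every club, the club contains a [ga] below some member
   [B] of the family with [c al be > i] for all [be] in [B] and all [al < ga] close
   to [ga].  Walk from [be] down to [al] along a C-sequence [e].  Enlarging each
   [e y] to an increasing sequence [enu nu y], [nu < la], of sets that are bounded
   below all points of cofinality above [nu], and collecting the least element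
   above [al] of each [enu nu y] with [y] on the walk, attaches to [al < be] a
   finite set [pts al be].  A club-guessing argument ([guess]) shows that the
   enlargements can be chosen so that for many [ga] some [B] above [ga] has
   [ga] in [pts al be] for all [be] in [B] and all [al] close to [ga].  Maximizing
   over [pts al be] therefore turns into a witness

   - any coloring [c] such that, for every stationary [S] and every club, some [ga]
     in [S] and some [t < ga] in the club satisfy [c al ga > i] for all [al < t]
     close to [t] ([hitting_U]);
   - any [h : ka -> theta] such that each set [h ga > i] is still guessed
     ([pos_U]).

   Closed colorings are of the first kind.  If [2 ^ la = la^+], one of the first
   kind is built by diagonalizing against [la] requirements below each [be].  If
   [2 ^ cf la < la], a function of the second kind factors through the cofinality
   of [ga]; all subsets of [cf la] are handled by a single intersection of clubs.
   Suppose reflection fails.  If some stationary set does not reflect at points of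
   cofinality at least [theta], walk along a C-sequence avoiding it.  Otherwise
   replace each set of the non-reflecting family by a set of points, of a fixed
   suitable cofinality, at which it reflects, and let each [e y] avoid one of the
   new sets: either the failure of a uniform bound for the walks gives an [h] of
   the second kind, or pressing down and walking to a common limit of the new sets
   produces an [e D] bounded below a point where it must be cofinal.
   The cases [cf theta = cf la] and [cf theta = omega] are direct, from injections
   of the [be < ka] into [la] and from the length of the walk. *)
Require Import Defs.
From mathcomp Require Import all_boot all_order.
From mathcomp Require Import boolp classical_sets functions cardinality.
From mathcomp Require Import wochoice.

Set Implicit Arguments.
Unset Strict Implicit.
Unset Printing Implicit Defensive.

Import Order.TTheory.

Local Open Scope classical_set_scope.
Local Open Scope card_scope.
Local Open Scope order_scope.

(** * Cardinal comparison by explicit injections *)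

Lemma card_leE (T U : Type) (u0 : U) (A : set T) (B : set U) :
  A #<= B <-> exists f : T -> U, (forall x, A x -> B (f x)) /\
     (forall x y, A x -> A y -> f x = f y -> x = y).
Proof.
split.
- move=> /card_leP[g].
  exists (fun x => if pselect (A x) is left Ax
                   then set_val (g (SigSub (mem_set Ax))) else u0).
  split => [x Ax|x y Ax Ay].
  + by case: pselect => // Ax'; apply: set_valP.
  + case: pselect => // Ax'; case: pselect => // Ay' /val_inj E.
    have := @inj _ _ _ g _ _ (mem_set I) (mem_set I) E.
    by case.
- move=> [f [fAB finj]].
  have fi : {in A &, injective f} by move=> x y /set_mem ? /set_mem ?; apply: finj.
  rewrite -(card_le_eql (inj_card_eq fi)).
  by apply: subset_card_le => _ [x Ax <-]; apply: fAB.
Qed.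

Lemma card_leX (T U V W : Type) (u0 : U) (w0 : W) (A : set T) (B : set U) (C : set V) (D : set W) :
  A #<= B -> C #<= D -> A `*` C #<= B `*` D.
Proof.
move=> /(card_leE u0)[f [fAB fi]] /(card_leE w0)[g [gCD gi]].
apply/(card_leE (u0, w0)); exists (fun p => (f p.1, g p.2)); split.
  by move=> [x y] [/= Ax Cy]; split => /=; [apply: fAB|apply: gCD].
move=> [x y] [x' y'] [/= Ax Cy] [/= Ax' Cy'] [/fi E1 /gi E2].
by rewrite E1 // E2.
Qed.

(** Hilbert's hotel: [x] takes the first place of a sequence [j] in [A], whose terms each move up by
    one. *)
Lemma infinite_adjoin (T : Type) (t0 : T) (A : set T) (x : T) : infinite_set A -> (A `|` [set x]) #<= A.
Proof.
move=> /infiniteP /(card_leE t0)[j [jA ji]].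
pose f y := if pselect (exists n, y = j n) is left h then j (projT1 (cid h)).+1
            else if pselect (y = x) is left _ then j 0%N else y.
apply/(card_leE t0); exists f; split.
  move=> y hy; rewrite /f; case: pselect => [h|_]; first by apply: jA.
  by case: pselect => [_|yx]; [apply: jA|case: hy].
move=> y z hy hz.
have hj m n : j m = j n -> m = n by apply: ji.
have fP u : [\/ exists2 n, u = j n & f u = j n.+1, u = x /\ f u = j 0%N |
               f u = u /\ forall n, u <> j n].
  rewrite /f; case: pselect => [h|nu].
    by apply: Or31; case: cid => n E /=; exists n.
  case: pselect => [->|_]; [by apply: Or32|apply: Or33]; split => // n E; apply: nu.
  by exists n.
case: (fP y) => [[n yE ->]|[yE ->]|[-> yn]];
  case: (fP z) => [[m zE ->]|[zE ->]|[-> zn]] //; do ?[by move/hj];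
  do ?[by move=> E; case: (zn _ (esym E))]; do ?[by move=> E; case: (yn _ E)].
- by move=> /hj[]; rewrite yE zE => ->.
- by rewrite yE zE.
Qed.

Lemma image_card_le (T U : Type) (u0 : T) (f : T -> U) (A : set T) (B : set U) :
  (forall y, B y -> exists2 x, A x & f x = y) -> B #<= A.
Proof.
move=> h; apply/(card_leE u0).
have h' y : exists x, B y -> A x /\ f x = y.
  by case: (pselect (B y)) => [/h[x]|]; [exists x|exists u0].
have [g gP] := choice h'; exists g; split => [y /gP[]//|x y /gP[_ E] /gP[_ E'] E''].
by rewrite -E -E' E''.
Qed.

Section Ordinals.
Context {d : Order.disp_t} {O : bOrderType d} (wfO : well_order (@Order.le d O)).

(** * Well-ordered types *)

Implicit Types (a b x y z : O) (A B X : set O).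

Lemma ex_least A x : A x -> exists y, is_least A y.
Proof.
move=> Ax; have [|y [[yA ymin] _]] := @wfO (mem A).
  by exists x; rewrite inE.
exists y; split; first by apply/set_mem; rewrite inE in yA; apply/mem_set.
by move=> z Az; apply: ymin; apply/mem_set.
Qed.

Lemma is_least_uniq A x y : is_least A x -> is_least A y -> x = y.
Proof. by move=> [Ax lx] [Ay ly]; apply/le_anti/andP; split; [apply: lx|apply: ly]. Qed.

Lemma leastE A x : is_least A x -> least A = x.
Proof. by move=> h; apply: xget_unique => // y h'; apply: is_least_uniq h. Qed.

Lemma leastP A x : A x -> A (least A) /\ lbound A (least A).
Proof. by move=> /ex_least[y ly]; rewrite (leastE ly). Qed.

Lemma least_mem A x : A x -> A (least A).
Proof. by move=> /leastP[]. Qed.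

Lemma least_le A x : A x -> least A <= x.
Proof. by move=> Ax; have [_] := leastP Ax; apply. Qed.

Lemma not_lt_least A x : x < least A -> ~ A x.
Proof. by move=> xl /least_le; rewrite leNgt xl. Qed.

Lemma owf : well_founded (fun x y : O => x < y).
Proof.
move=> x; apply: contrapT => nx.
have [y [ny ly]] := @ex_least (fun x => ~ Acc (fun x y : O => x < y) x) x nx.
apply: ny; constructor => z zy; apply: contrapT => /ly; by rewrite leNgt zy.
Qed.

Lemma oind (P : O -> Prop) : (forall x, (forall y, y < x -> P y) -> P x) -> forall x, P x.
Proof. by move=> h x; elim: (owf x) => {}x _ ih; apply: h. Qed.

(** Recursion with choice: the value at [u] is some [t] allowed by [P], or [t0] if there is none.
    Since [f] exists unconditionally, the existence of allowed values can be proved afterwards by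
    induction. *)
Lemma wfrec_gen (U T : Type) (R : U -> U -> Prop) (P : U -> (U -> T) -> T -> Prop) (t0 : T) :
  well_founded R ->
  (forall u g h t, (forall v, R v u -> g v = h v) -> P u g t -> P u h t) ->
  exists f : U -> T, forall u, (exists t, P u f t) -> P u f (f u).
Proof.
move=> wfR Pext.
pose F u (g : U -> T) : T :=
   if pselect (exists t, P u g t) is left h then projT1 (cid h) else t0.
have Fext u g h : (forall v, R v u -> g v = h v) -> F u g = F u h.
  move=> gh; rewrite /F.
  have E : P u g = P u h.
    apply/funext => t; apply/propext; split; apply: Pext => // v vx.
    by rewrite gh.
  by rewrite E.
pose G u (rec : forall v, R v u -> T) : T :=
  F u (fun v => if pselect (R v u) is left h then rec v h else t0).
pose f := Fix wfR (fun _ => T) G.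
have fE u : f u = F u f.
  rewrite {1}/f Fix_eq => [|{}u g h gh].
    by apply: Fext => v vx; case: pselect.
  by congr (F u _); apply/funext => v; case: pselect.
exists f => u ex; rewrite fE /F; case: pselect => // ex'.
by case: cid.
Qed.

Lemma wfrec_choice (T : Type) (P : O -> (O -> T) -> T -> Prop) (t0 : T) :
  (forall x g h t, (forall y, y < x -> g y = h y) -> P x g t -> P x h t) ->
  exists f : O -> T, forall x, (exists t, P x f t) -> P x f (f x).
Proof. exact: wfrec_gen t0 owf. Qed.

Lemma bot_le x : (\bot : O) <= x. Proof. exact: le0x. Qed.

Lemma neq_bot_gt x : x != \bot -> (\bot : O) < x.
Proof. by rewrite lt0x. Qed.

Lemma ord_supP A b : (forall x, A x -> x <= b) ->
  (forall x, A x -> x <= ord_sup A) /\ (forall c, (forall x, A x -> x <= c) -> ord_sup A <= c).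
Proof.
move=> Ab; rewrite /ord_sup /supremum; case: ifPn => [/eqP A0|/set0P[x0 Ax0]].
  by split => [x|c _]; [rewrite A0|exact: bot_le].
have [s [sub smin]] := @ex_least (ubound A) b Ab.
have sups : supremums A s by split.
case: xgetP => [y _ [yub ymin]|/(_ s)//].
by split=> // c cA; apply: ymin.
Qed.

Lemma ord_sup_ge A b x : (forall y, A y -> y <= b) -> A x -> x <= ord_sup A.
Proof. by move=> /ord_supP[h _]; apply: h. Qed.

Lemma ord_sup_le A b : (forall y, A y -> y <= b) -> ord_sup A <= b.
Proof. by move=> h; have [_] := ord_supP h; apply. Qed.

Lemma ord_sup_lt A b x : (forall y, A y -> y <= b) -> x < ord_sup A ->
  exists2 y, A y & x < y.
Proof.
move=> Ab xs; apply: contrapT => ne.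
have : ord_sup A <= x.
  apply: ord_sup_le => y Ay; rewrite leNgt; apply/negP => xy; apply: ne; by exists y.
by rewrite leNgt xs.
Qed.

(* Vacuously true for [g = \bot]. *)
Definition cofin A g := forall x, x < g -> exists y, [/\ A y, x < y & y < g].

Lemma cofin_sup A g : cofin A g -> ord_sup (A `&` below g) = g.
Proof.
move=> cA; have ub y : (A `&` below g) y -> y <= g by case=> _ /ltW.
apply/le_anti/andP; split; first exact: ord_sup_le.
rewrite leNgt; apply/negP => /cA[y [Ay sy yg]].
have := ord_sup_ge ub (conj Ay yg : (A `&` below g) y); by rewrite leNgt sy.
Qed.

Lemma sup_cofin A g : ord_sup (A `&` below g) = g -> cofin A g.
Proof.
move=> E x xg; have ub y : (A `&` below g) y -> y <= g by case=> _ /ltW.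
have := xg; rewrite -{1}E => /(ord_sup_lt ub)[y [Ay yg] xy].
by exists y.
Qed.

Lemma not_cofin A g : ~ cofin A g -> exists2 e, e < g & forall x, A x -> x < g -> x <= e.
Proof.
move=> nc; apply: contrapT => ne; apply: nc => x xg.
apply: contrapT => ne2; apply: ne; exists x => // y Ay yg.
rewrite leNgt; apply/negP => xy; apply: ne2; by exists y.
Qed.

Definition olim g := (\bot < g) /\ cofin setT g.

Lemma cofin_sub A B g : A `<=` B -> cofin A g -> cofin B g.
Proof. by move=> AB h x /h[y [/AB ? ? ?]]; exists y. Qed.

(** Meaningful only when something lies above [x]: at a greatest element of [O] the value is
    [\bot]. *)
Definition osucc x : O := least [set y | x < y].

Lemma osucc_gt x y : x < y -> x < osucc x.
Proof. by move=> xy; apply: (@least_mem [set y | x < y] y). Qed.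

Lemma osucc_le x y : x < y -> osucc x <= y.
Proof. by move=> xy; apply: least_le. Qed.

Lemma olim_succ g x : olim g -> x < g -> x < osucc x /\ osucc x < g.
Proof.
move=> [_ h] /h[y [_ xy yg]]; split; first exact: osucc_gt xy.
exact: le_lt_trans (osucc_le xy) yg.
Qed.

Lemma olimP g : \bot < g -> ~ olim g -> exists2 p, p < g & forall x, x < g -> x <= p.
Proof.
move=> g0 nl; have /not_cofin[e eg h] : ~ cofin setT g by move=> c; apply: nl.
by exists e => // x; apply: h.
Qed.

(** * Cardinals and cofinality *)

Lemma below_le a b : a <= b -> below a #<= below b.
Proof. by move=> ab; apply: subset_card_le => x /= xa; apply: lt_le_trans xa ab. Qed.

Lemma not_card_lt_below a b : ~ card_lt (below a) (below b) -> below b #<= below a.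
Proof.
move=> h; case: (leP b a) => [/below_le//|ab].
apply: contrapT => nba; apply: h; split => //; exact/below_le/ltW.
Qed.

Lemma cardinal_lt a b : is_cardinal a -> b < a -> ~ (below a #<= below b).
Proof.
move=> ca ba h; apply: (ca b ba); apply: Cantor_Bernstein => //.
exact/below_le/ltW.
Qed.

Lemma ex_cardinal a : exists b, [/\ b <= a, is_cardinal b & below b #= below a].
Proof.
have [b [eb lb]] := @ex_least (fun b => below b #= below a) a (card_eqxx _).
exists b; split => //; first by apply: lb; apply: card_eqxx.
move=> c cb E; have := lb c (card_eq_trans E eb); by rewrite leNgt cb.
Qed.

Lemma infinite_cardinal_lim a : is_cardinal a -> infinite_set (below a) -> olim a.
Proof.
move=> ca ia; apply: contrapT => nl.
have a0 : \bot < a.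
  apply: neq_bot_gt; apply/eqP => E; apply: ia; rewrite E.
  by apply: (sub_finite_set _ (finite_set0 O)) => x; rewrite /below /= ltx0.
have [p pa hp] := olimP a0 nl.
have E : below a = below p `|` [set p].
  apply/seteqP; split => [x /= xa|x [/= xp|/= ->]] //=; last exact: lt_trans xp pa.
  by have := hp x xa; rewrite le_eqVlt => /orP[/eqP->|]; [right|left].
apply: (cardinal_lt ca pa); rewrite E; apply: infinite_adjoin; first exact: \bot.
move=> fp; apply: ia; rewrite E finite_setU; by split.
Qed.

Lemma infinite_le a b : a <= b -> infinite_set (below a) -> infinite_set (below b).
Proof. by move=> ab ia fb; apply: ia; apply: card_le_finite fb; apply: below_le. Qed.

Lemma infinite_pos a : infinite_set (below a) -> \bot < a.
Proof. by move=> /infinite_setN0[x /= xa]; apply: le_lt_trans (bot_le x) xa. Qed.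

(** * Gödel's well-ordering of pairs and squares of infinite ordinals *)

Definition godel (p q : O * O) : Prop :=
  Order.max p.1 p.2 < Order.max q.1 q.2 \/
  (Order.max p.1 p.2 = Order.max q.1 q.2 /\ (p.1 < q.1 \/ (p.1 = q.1 /\ p.2 < q.2))).

Lemma godel_wf : well_founded godel.
Proof.
suff h m x y : Order.max x y = m -> Acc godel (x, y) by case=> x y; exact: h erefl.
elim/oind: m x y => m ihm; elim/oind => x ihx; elim/oind => y ihy E.
constructor => -[x' y'] [/=|[/=]]; first by rewrite E => /ihm; apply.
rewrite E => E' [lx|[xx ly]]; first exact: ihx lx _ E'.
by rewrite xx in E' *; apply: ihy ly E'.
Qed.

Lemma godel_total p q : [\/ godel p q, p = q | godel q p].
Proof.
case: p q => x y [x' y']; rewrite /godel /=.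
case: (ltgtP (Order.max x y) (Order.max x' y')) => E; [by apply: Or31; left| by apply: Or33; left|].
case: (ltgtP x x') => E1; [by apply: Or31; right; split=> //; left|by apply: Or33; right; split=> //; left|].
case: (ltgtP y y') => E2; [by apply: Or31; right; split=> //; right|by apply: Or33; right; split=> //; right|].
by apply: Or32; rewrite E1 E2.
Qed.

Lemma mex_card_le (U : Type) (R : U -> U -> Prop) (Q : set U) a :
  well_founded R -> (forall p q, [\/ R p q, p = q | R q p]) ->
  (forall p, Q p -> ~ (below a #<= (Q `&` [set q | R q p]))) -> Q #<= below a.
Proof.
move=> wfR tot hQ.
(* [f p] avoids all values at the predecessors of [p]; these never exhaust [below a]. *)
pose P p (g : U -> O) t := t < a /\ forall q, Q q -> R q p -> g q <> t.
have [p g h t gh [ta ht]|f fP] := @wfrec_gen U O R P \bot wfR.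
  by split => // q Qq Rq; rewrite -gh //; apply: ht.
have fQ p : Q p -> P p f (f p).
  move=> Qp; apply: fP; apply: contrapT => ne; apply: (hQ p Qp).
  apply: (image_card_le p (f := f)) => y ya.
  apply: contrapT => ny; apply: ne; exists y; split => // q Qq Rq E.
  by apply: ny; exists q.
apply/(card_leE \bot); exists f; split => [p /fQ[]//|p q Qp Qq E].
have [_ hp] := fQ p Qp; have [_ hq] := fQ q Qq.
have [/(hq _ Qp)|//|/(hp _ Qq)] := tot p q; by rewrite E.
Qed.

(** The pairs preceding a given pair lie in a square over some [m < a]. By induction this square is
    too small to contain a copy of [below a], which is what [mex_card_le] asks for. *)
Lemma hessenberg_card a : is_cardinal a -> infinite_set (below a) ->
  below a `*` below a #<= below a.
Proof.
elim/oind: a => a ih ca ia; have la := infinite_cardinal_lim ca ia.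
apply: (mex_card_le godel_wf godel_total) => -[x y] [/= xa ya] hle.
have ma : Order.max x y < a by rewrite gt_max xa ya.
have [mm] := olim_succ la ma; set m := osucc _ in mm * => m_a.
have {}hle : below a #<= below m `*` below m.
  apply: card_le_trans hle _; apply: subset_card_le => -[x' y'] [_ /= g].
  have : Order.max x' y' <= Order.max x y by case: g => [/ltW|[-> _]].
  by rewrite ge_max => /andP[xx yy]; split => /=; apply: le_lt_trans mm.
have [fm|im] := pselect (finite_set (below m)).
  by apply: ia; apply: card_le_finite hle _; apply: finite_setX.
have [b [bm cb /card_eqPle[E1 E2]]] := ex_cardinal m.
have ib : infinite_set (below b) by move=> fb; apply: im; apply: card_le_finite fb.
apply: (cardinal_lt ca m_a); apply: card_le_trans hle _.
apply: card_le_trans (card_leX \bot \bot E2 E2) _.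
apply: card_le_trans (ih b _ cb ib) E1; exact: le_lt_trans bm m_a.
Qed.

Lemma hessenberg a : infinite_set (below a) -> below a `*` below a #<= below a.
Proof.
move=> ia; have [b [bm cb /card_eqPle[E1 E2]]] := ex_cardinal a.
have ib : infinite_set (below b) by move=> fb; apply: ia; apply: card_le_finite fb.
apply: card_le_trans (card_leX \bot \bot E2 E2) _.
exact: card_le_trans (hessenberg_card cb ib) E1.
Qed.

(** * Cofinality and regular ordinals *)

Lemma cf_spec a : (exists f, cofinal_map (cf a) a f) /\
  forall b, b < cf a -> forall f, ~ cofinal_map b a f.
Proof.
have h : exists f : O -> O, cofinal_map a a f by exists id; split => // y ya; exists y.
have [c l] := @leastP (fun b => exists f : O -> O, cofinal_map b a f) a h.
split => // b bc f fP; have := l b (ex_intro _ f fP); by rewrite leNgt bc.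
Qed.

Lemma cf_le_map b a f : cofinal_map b a f -> cf a <= b.
Proof. by move=> h; rewrite leNgt; apply/negP => /(proj2 (cf_spec a)) /(_ f h). Qed.

Lemma cf_le a : cf a <= a.
Proof. by apply: (@cf_le_map a a id); split => // y ya; exists y. Qed.

Lemma cf_gt_lim x y : \bot < x -> x < cf y -> olim y.
Proof.
move=> x0 xc; apply: contrapT => nl.
have y0 : \bot < y by apply: lt_le_trans (cf_le y); apply: lt_trans x0 xc.
have [p py hp] := olimP y0 nl.
have : cf y <= x; last by rewrite leNgt xc.
apply: (@cf_le_map x y (fun=> p)); split => // z zy; exists \bot => //; exact: hp.
Qed.

(** Choose elements of [X] greedily in increasing order. The recursion cannot stop before stage
    [cf a], since the values chosen so far would be cofinal in [a]. *)
Lemma cof_card a X : olim a -> X `<=` below a -> (forall y, y < a -> exists2 x, X x & y <= x) ->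
  below (cf a) #<= X.
Proof.
move=> la Xa Xu.
pose P x (g : O -> O) t := X t /\ forall y, y < x -> g y < t.
have [x g h t gh [Xt ht]|f fP] := @wfrec_choice O P \bot.
  by split => // y yx; rewrite -gh //; apply: ht.
have fX x : x < cf a -> P x f (f x).
  elim/oind: x => x ih xc; apply: fP; apply: contrapT => ne.
  have [_ /(_ x xc f)] := cf_spec a; apply; split.
    by move=> y yx; apply: Xa; apply: (ih y yx (lt_trans yx xc)).1.
  move=> z za; have [t Xt zt] := Xu z za.
  apply: contrapT => nz; apply: ne; exists t; split => // y yx.
  rewrite ltNge; apply/negP => ty; apply: nz; exists y => //; exact: le_trans zt ty.
apply/(card_leE \bot); exists f; split => [x /fX[]//|x y xc yc E].
case: (ltgtP x y) => // h; exfalso.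
  by have := (fX y yc).2 x h; rewrite E ltxx.
by have := (fX x xc).2 y h; rewrite E ltxx.
Qed.

(** Fewer than [cf a] elements, in a form that accepts index sets of every type. *)
Definition small a (U : Type) (P : set U) := ~ (below (cf a) #<= P).

Lemma small_le a (U V : Type) (P : set U) (Q : set V) : Q #<= P -> small a P -> small a Q.
Proof. by move=> QP sP h; apply: sP; apply: card_le_trans h QP. Qed.

Lemma bounded_img a (U : Type) (P : set U) (f : U -> O) : olim a -> small a P ->
  (forall p, P p -> f p < a) -> exists2 y, y < a & forall p, P p -> f p < y.
Proof.
move=> la sP fa; apply: contrapT => ne; apply: sP.
apply: card_le_trans (card_image_le f P); apply: cof_card => //.
  by move=> _ [p Pp <-]; apply: fa.
move=> y ya; apply: contrapT => ny; apply: ne; exists y => // p Pp.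
rewrite ltNge; apply/negP => yf; apply: ny; exists (f p) => //; by exists p.
Qed.

(** An injection of [cf a] into [b] would turn a cofinal map on [cf a] into one on [b]. *)
Lemma small_below a b : olim a -> b < cf a -> small a (below b).
Proof.
move=> [a0 _] bc /(card_leE \bot)[i [ib ii]].
have [[f [fa fc]] /(_ b bc)] := cf_spec a.
pose g x := if pselect (exists2 z, z < cf a & i z = x) is left h
            then f (projT1 (cid2 h)) else \bot.
move=> /(_ g); apply; split => [x xb|y ya].
  by rewrite /g; case: pselect => // h; case: cid2 => z zc _ /=; apply: fa.
have [z zc yz] := fc y ya; exists (i z); first exact: ib.
rewrite /g; case: pselect => [h|[]]; last by exists z.
by case: cid2 => z' zc' /= /ii ->.
Qed.

Lemma small_card_le a b (U : Type) (P : set U) : olim a -> b < cf a -> P #<= below b -> small a P.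
Proof. by move=> la bc; move/small_le; apply; apply: small_below. Qed.

Lemma bounded_below a b f : olim a -> b < cf a -> (forall x, x < b -> f x < a) ->
  exists2 y, y < a & forall x, x < b -> f x < y.
Proof. by move=> la bc fa; apply: bounded_img => //; apply: small_below. Qed.

Lemma cf_gt0 a : \bot < a -> \bot < cf a.
Proof.
move=> a0; apply: neq_bot_gt; apply/eqP => E.
have [[f [_ h]] _] := cf_spec a; have [x] := h _ a0; by rewrite E ltx0.
Qed.

Lemma cf_lim a : olim a -> olim (cf a).
Proof.
move=> la; apply: contrapT => nl; have [a0 ca] := la.
have [p pc hp] := olimP (cf_gt0 a0) nl.
have [[f [fa fc]] _] := cf_spec a.
have [y ya fy] := bounded_below la pc (fun x xp => fa x (lt_trans xp pc)).
have [z [_ mz za]] : exists z, [/\ setT z, Order.max y (f p) < z & z < a].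
  by apply: ca; rewrite gt_max ya fa.
have [x xc zx] := fc z za; have := hp x xc; rewrite le_eqVlt => /orP[/eqP E|xp].
  by move: mz; rewrite gt_max -E => /andP[_]; rewrite ltNge zx.
move: mz; rewrite gt_max => /andP[yz _]; have := fy x xp; by rewrite ltNge (le_trans (ltW yz) zx).
Qed.

(** Running suprema make a cofinal map monotone; they stay below [a], being taken over fewer than
    [cf a] values. *)
Lemma cf_cofinal a : olim a -> exists f : O -> O, [/\ forall x, x < cf a -> f x < a,
   forall x y, x <= y -> y < cf a -> f x <= f y &
   forall y, y < a -> exists2 x, x < cf a & y < f x].
Proof.
move=> la; have [[f [fa fc]] _] := cf_spec a; have lc := cf_lim la.
pose g x := ord_sup [set f y | y in [set y | y <= x]].
have gb x : x < cf a -> exists2 b, b < a & forall y, y <= x -> f y <= b.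
  move=> xc; have [x1 x2] := olim_succ lc xc.
  have [b ba hb] := bounded_below la x2 (fun y yx => fa y (lt_trans yx x2)).
  by exists b => // y yx; apply/ltW/hb; apply: le_lt_trans yx x1.
have gP x : x < cf a -> [/\ g x < a & forall y, y <= x -> f y <= g x].
  move=> xc; have [b ba hb] := gb x xc.
  have ub z : [set f y | y in [set y | y <= x]] z -> z <= b by move=> [w wx <-]; exact: hb.
  split; first by apply: le_lt_trans ba; apply: ord_sup_le.
  by move=> y yx; apply: (ord_sup_ge ub); exists y.
exists g; split => [x /gP[]//|x y xy yc|y ya].
  apply: ord_sup_le => _ [z zx <-]; have [_] := gP y yc; apply; exact: le_trans zx xy.
have [z [_ yz za]] := la.2 y ya; have [x xc zx] := fc z za; exists x => //.
have [_ /(_ x (lexx x))] := gP x xc; exact: lt_le_trans (lt_le_trans yz zx).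
Qed.

Lemma cf_cf a : olim a -> cf (cf a) = cf a.
Proof.
move=> la; apply/le_anti; rewrite cf_le /=; have lc := cf_lim la.
have [f [fa fm fc]] := cf_cofinal la; have [g [ga gm gc]] := cf_cofinal lc.
apply: (@cf_le_map _ _ (f \o g)); split => [x xc|y ya] /=; first exact/fa/ga.
have [x xc yx] := fc y ya; have [z zc xz] := gc x xc; exists z => //.
by apply: (le_trans (ltW yx)); apply: fm; [exact: ltW|exact: ga].
Qed.

Lemma cf_cardinal a : olim a -> is_cardinal (cf a).
Proof.
move=> la b bc /card_eqPle[_ h]; exact: (small_below la bc).
Qed.

Definition regular a := olim a /\ cf a = a.

Lemma cf_regular a : olim a -> regular (cf a).
Proof. by move=> la; split; [exact: cf_lim|exact: cf_cf]. Qed.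

Lemma lim_infinite a : olim a -> infinite_set (below a).
Proof.
move=> la; apply/infiniteP; pose s n := iter n osucc (\bot : O).
have sa n : s n < a by elim: n => [|n ih]; [exact: la.1|exact: (olim_succ la ih).2].
have sS n : s n < s n.+1 by exact: (olim_succ la (sa n)).1.
have smono m n : (m < n)%N -> s m < s n.
  elim: n => // n ih; rewrite ltnS leq_eqVlt => /orP[/eqP->//|/ih h]; exact: lt_trans h (sS n).
apply/(card_leE \bot); exists s; split => [n _|m n _ _ E]; first exact: sa.
case: (ltngtP m n) => // /smono; by rewrite E ltxx.
Qed.

Lemma succ_cardinal_props nu ka : infinite_set (below nu) -> is_succ_cardinal nu ka ->
  [/\ nu < ka, is_cardinal ka, infinite_set (below ka), regular ka &
      forall x, x < ka -> below x #<= below nu].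
Proof.
move=> inu [[nk nkn] lk].
have nuka : nu < ka by rewrite ltNge; apply/negP => /below_le /nkn.
have hx x : x < ka -> below x #<= below nu.
  move=> xk; apply: not_card_lt_below => /lk; by rewrite leNgt xk.
have ck : is_cardinal ka.
  by move=> b bk /card_eqPle[_ h]; apply: nkn; apply: card_le_trans h (hx b bk).
have ik : infinite_set (below ka) by apply: infinite_le inu; exact: ltW.
have limk := infinite_cardinal_lim ck ik.
split => //; split => //; apply/le_anti; rewrite cf_le leNgt; apply/negP => ck2.
have [f [fk fm fc]] := cf_cofinal limk.
(* If [cf ka < ka], then [ka] is a union of at most [nu] sets of size at most [nu], and injects into
   the square of [nu]. *)
have h1 x : exists g : O -> O, x < cf ka -> (forall z, z < f x -> g z < nu) /\
     (forall z z', z < f x -> z' < f x -> g z = g z' -> z = z').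
  case: (pselect (x < cf ka)) => xc; last by exists id.
  by have /(card_leE \bot)[g gP] := hx _ (fk x xc); exists g.
have [g gP] := choice h1.
have h2 y : exists x, y < ka -> x < cf ka /\ y < f x.
  case: (pselect (y < ka)) => [/fc[x xc yx]|]; last by exists \bot.
  by exists x.
have [k kP] := choice h2.
apply: nkn; apply: card_le_trans (hessenberg inu).
have /(card_leE \bot)[e [en ei]] := hx _ ck2.
apply/(card_leE (\bot, \bot)); exists (fun y => (e (k y), g (k y) y)); split.
  by move=> y /kP[kc yk]; split => /=; [exact: en|exact: (gP _ kc).1].
move=> y z yk zk [] /ei E; have [kc yf] := kP y yk; have [kc' zf] := kP z zk.
move: (E kc kc') => E1; rewrite E1 in yf *; exact: (gP _ kc').2.
Qed.

(** * Clubs, stationary sets and thin sets *)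

Implicit Types (al g de si : O) (C S : set O).

(** Smallness of [nat] stands for [omega < cf al], so that [bounded_img] applies directly to
    sequences. *)
Definition uncountable_cf al := olim al /\ small al [set: nat].

Lemma uncountable_cfP al nu : infinite_set (below nu) -> nu < cf al -> uncountable_cf al.
Proof.
move=> inu nc; have la := cf_gt_lim (infinite_pos inu) nc; split => //.
exact: small_card_le la nc (iffLR (infiniteP _) inu).
Qed.

Lemma clubP al C : club al C <-> [/\ C `<=` below al,
    forall x, x < al -> exists y, [/\ C y, x < y & y < al] &
    forall g, \bot < g -> g < al -> cofin C g -> C g].
Proof.
split=> -[Ca Cu Cc]; split => //.
- by move=> x /Cu[y Cy xy]; exists y; split => //; apply: Ca.
- by move=> g g0 ga /cofin_sup; apply: Cc => //; rewrite -lt0x.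
- by move=> x /Cu[y [Cy xy _]]; exists y.
- by move=> g; rewrite -lt0x => g0 ga /sup_cofin; apply: Cc.
Qed.

(** [g] is the supremum of a sequence of [R]-steps from [x], and stays below [al] by uncountable
    cofinality. Unboundedness of intersections, diagonal intersections and sets of limit points all
    comes from here. *)
Lemma closure_point al (R : O -> O -> Prop) : uncountable_cf al ->
  (forall x, x < al -> exists y, [/\ x < y, y < al & R x y]) ->
  forall x, x < al -> exists g, [/\ x < g, g < al & forall z, z < g ->
    exists y y', [/\ x <= y, z < y, y < y', y' < g & R y y']].
Proof.
move=> [la sn] h x xa.
have h' y : exists y', y < al -> [/\ y < y', y' < al & R y y'].
  by case: (pselect (y < al)) => [/h[y']|]; [exists y'|exists y].
have [k kP] := choice h'.
pose s n := iter n k x.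
have sa n : s n < al by elim: n => // n /kP[].
have sS n : s n < s n.+1 by have [] := kP _ (sa n).
have [b ba hb] := bounded_img la sn (fun n _ => sa n).
have ub y : [set s n | n in [set: nat]] y -> y <= b by move=> [n _ <-]; apply/ltW/hb.
pose g := ord_sup [set s n | n in [set: nat]].
have sg n : s n < g by apply: lt_le_trans (sS n) _; apply: (ord_sup_ge ub); exists n.+1.
have xs n : x <= s n by elim: n => // n ih; apply: le_trans ih _; exact/ltW/sS.
exists g; split; first exact: (sg 0%N).
  by apply: le_lt_trans ba; exact: ord_sup_le.
move=> z /(ord_sup_lt ub)[_ [n _ <-] zs]; exists (s n), (s n.+1); split => //.
by have [] := kP _ (sa n).
Qed.

Lemma club_bigcap al (U : Type) (P : set U) (C : U -> set O) : uncountable_cf al -> small al P ->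
  (forall p, P p -> club al (C p)) -> club al [set x | x < al /\ forall p, P p -> C p x].
Proof.
move=> ua sP hC; have [la _] := ua; apply/clubP; split => [x []//|x xa|g g0 ga cg]; last first.
  split => // p Pp; have /clubP[_ _] := hC p Pp; apply => //.
  by apply: cofin_sub cg => y [_ /(_ p Pp)].
pose R y y' := forall p, P p -> exists z, [/\ C p z, y < z & z < y'].
have hR y : y < al -> exists y', [/\ y < y', y' < al & R y y'].
  move=> ya.
  have h p : exists z, P p -> [/\ C p z, y < z & z < al].
    case: (pselect (P p)) => [Pp|]; last by exists y.
    by have /clubP[_ /(_ y ya)[z zP] _] := hC p Pp; exists z.
  have [k kP] := choice h.
  have [b ba hb] := bounded_img la sP (fun p Pp => let: And3 _ _ h := kP p Pp in h).
  have [w [_ mw wa]] : exists w, [/\ setT w, Order.max y b < w & w < al].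
    by apply: la.2; rewrite gt_max ya ba.
  move: mw; rewrite gt_max => /andP[yw bw].
  exists w; split => // p Pp; have [Ck yk ka] := kP p Pp; exists (k p); split => //.
  exact: lt_trans (hb p Pp) bw.
have [g [xg ga hg]] := closure_point ua hR xa.
exists g; split => //; split => // p Pp; have /clubP[_ _] := hC p Pp; apply => //.
  exact: le_lt_trans (bot_le x) xg.
move=> z /hg[y [y' [_ zy yy' y'g /(_ p Pp)[w [Cw yw wy']]]]].
exists w; split => //; [exact: lt_trans yw|exact: lt_trans y'g].
Qed.

Lemma small_bool al : olim al -> small al [set: bool].
Proof.
move=> la; apply: contra_not (lim_infinite (cf_lim la)).
by move/card_le_finite; apply; exact: finite_finset.
Qed.

Lemma club_setI al C C' : uncountable_cf al -> club al C -> club al C' -> club al (C `&` C').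
Proof.
move=> ua cC cC'.
have hP (q : bool) : [set: bool] q -> club al (if q then C else C') by case: q.
have := club_bigcap ua (@small_bool _ ua.1) hP.
congr club; apply/seteqP; split => [x [_ h]|x [Cx C'x]].
  by split; [exact: (h true)|exact: (h false)].
by split; [case: cC => h _ _; exact: h|case].
Qed.

Lemma club_below al : olim al -> club al (below al).
Proof.
by move=> la; apply/clubP; split => // x /(la.2)[y [_ xy ya]]; exists y.
Qed.

Lemma club_above al e : olim al -> e < al -> club al [set x | e < x /\ x < al].
Proof.
move=> la ea; apply/clubP; split => [x []//|x xa|g g0 ga cg].
  have [y [_ my ya]] : exists w, [/\ setT w, Order.max x e < w & w < al].
    by apply: la.2; rewrite gt_max xa ea.
  by move: my; rewrite gt_max => /andP[? ?]; exists y.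
have [y [[ey _] _ yg]] := cg _ g0; split => //; exact: lt_trans yg.
Qed.

Lemma club_acc al X : uncountable_cf al ->
  (forall x, x < al -> exists y, [/\ X y, x < y & y < al]) ->
  club al [set g | [/\ \bot < g, g < al & cofin X g]].
Proof.
move=> ua Xu; apply/clubP; split => [x []//|x xa|g g0 ga cg].
  pose R y y' := exists2 w, X w & y < w /\ w < y'.
  have hR y : y < al -> exists y', [/\ y < y', y' < al & R y y'].
    move=> ya; have [w [Xw yw wa]] := Xu y ya; have [w1 w2] := olim_succ ua.1 wa.
    by exists (osucc w); split => //; [exact: lt_trans w1|exists w].
  have [g [xg ga hg]] := closure_point ua hR xa.
  exists g; split => //; split => //; first exact: le_lt_trans (bot_le x) xg.
  move=> z /hg[y [y' [_ zy yy' y'g [w Xw [yw wy']]]]].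
  exists w; split => //; [exact: lt_trans yw|exact: lt_trans y'g].
split => // z /cg[w [[_ wa cw] zw wg]]; have [v [Xv zv vw]] := cw z zw.
by exists v; split => //; exact: lt_trans wg.
Qed.

Lemma stationary_club al S C : uncountable_cf al -> stationary al S -> club al C ->
  stationary al (C `&` S).
Proof.
move=> ua sS cC D cD; have [x [[Dx Cx] Sx]] := sS _ (club_setI ua cD cC).
by exists x.
Qed.

Lemma stationary_unbounded al S x : uncountable_cf al -> stationary al S -> x < al ->
  exists y, [/\ S y, x < y & y < al].
Proof.
move=> [la _] sS xa; have [y [[xy ya] Sy]] := sS _ (club_above la xa); by exists y.
Qed.

Lemma stationary_bigcup al S (U : Type) (P : set U) (Q : U -> set O) : uncountable_cf al ->
  stationary al S -> small al P ->
  (forall x, S x -> x < al -> exists2 p, P p & Q p x) ->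
  exists2 p, P p & stationary al (S `&` Q p).
Proof.
move=> ua sS sP h; apply: contrapT => ne.
have h' p : exists C, P p -> club al C /\ forall x, C x -> S x -> ~ Q p x.
  case: (pselect (P p)) => [Pp|]; last by exists setT.
  have : ~ stationary al (S `&` Q p) by move=> st; apply: ne; exists p.
  move/existsNP => [C /not_implyP[cC nC]]; exists C => _; split => // x Cx Sx Qx.
  by apply: nC; exists x.
have [C hC] := choice h'.
have [x [[xa Cx] Sx]] := sS _ (club_bigcap ua sP (fun p Pp => (hC p Pp).1)).
have [p Pp Qx] := h x Sx xa; exact: (hC p Pp).2 (Cx p Pp) Sx Qx.
Qed.

Lemma club_diag ka (C : O -> set O) : uncountable_cf ka -> cf ka = ka ->
  (forall x, x < ka -> club ka (C x)) -> club ka [set g | g < ka /\ forall x, x < g -> C x g].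
Proof.
move=> ua ck hC; have [la _] := ua; apply/clubP; split => [x []//|x xa|g g0 ga cg]; last first.
  split => // x xg; have /clubP[_ _] := hC x (lt_trans xg ga); apply => // z zg.
  have [y [[_ hy] my yg]] : exists y, [/\ [set g | g < ka /\ (forall x, x < g -> C x g)] y, Order.max x z < y & y < g].
    by apply: cg; rewrite gt_max xg zg.
  by move: my; rewrite gt_max => /andP[/hy ? ?]; exists y.
pose R y y' := forall x, x <= y -> exists z, [/\ C x z, y < z & z < y'].
have hR y : y < ka -> exists y', [/\ y < y', y' < ka & R y y'].
  move=> ya; have [y1 y2] := olim_succ la ya.
  have h p : exists z, p < osucc y -> [/\ C p z, y < z & z < ka].
    case: (pselect (p < osucc y)) => [Pp|]; last by exists y.
    by have /clubP[_ /(_ y ya)[z zP] _] := hC p (lt_trans Pp y2); exists z.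
  have [k kP] := choice h.
  have sc : osucc y < cf ka by rewrite ck.
  have [b ba hb] := bounded_below la sc (fun p Pp => let: And3 _ _ h := kP p Pp in h).
  have [w [_ mw wa]] : exists w, [/\ setT w, Order.max y b < w & w < ka].
    by apply: la.2; rewrite gt_max ya ba.
  move: mw; rewrite gt_max => /andP[yw bw].
  exists w; split => // p py; have ps := le_lt_trans py y1; have [Ck yk kk] := kP p ps.
  exists (k p); split => //; exact: lt_trans (hb p ps) bw.
have [g [xg ga hg]] := closure_point ua hR xa.
exists g; split => //; split => // u ug; have /clubP[_ _] := hC u (lt_trans ug ga); apply => //.
  exact: le_lt_trans (bot_le x) xg.
move=> z zg; have mg : Order.max u z < g by rewrite gt_max ug zg.
have [y [y' [_]]] := hg _ mg; rewrite gt_max => /andP[uy zy] yy' y'g /(_ u (ltW uy))[w [Cw yw wy']].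
exists w; split => //; [exact: lt_trans yw|exact: lt_trans y'g].
Qed.

Lemma fodor ka S (f : O -> O) : uncountable_cf ka -> cf ka = ka -> stationary ka S ->
  (forall x, S x -> x < ka -> f x < x) -> exists2 e, e < ka & stationary ka (S `&` [set x | f x = e]).
Proof.
move=> ua ck sS fS; apply: contrapT => ne.
have h' p : exists C, p < ka -> club ka C /\ forall x, C x -> S x -> f x <> p.
  case: (pselect (p < ka)) => [Pp|]; last by exists setT.
  have : ~ stationary ka (S `&` [set x | f x = p]) by move=> st; apply: ne; exists p.
  move/existsNP => [C /not_implyP[cC nC]]; exists C => _; split => // x Cx Sx Qx.
  by apply: nC; exists x.
have [C hC] := choice h'.
have [x [[xa Cx] Sx]] := sS _ (club_diag ua ck (fun p Pp => (hC p Pp).1)).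
have fx := fS x Sx xa; exact: (hC _ (lt_trans fx xa)).2 (Cx _ fx) Sx erefl.
Qed.

(** The supremum of an increasing [si]-sequence in [C] above [x] is as required. *)
Lemma club_cof_point al si C x : olim al -> regular si -> si < cf al -> club al C -> x < al ->
  exists de, [/\ C de, x < de, de < al & cf de = si].
Proof.
move=> la [ls cs] sa /clubP[Ca Cu Cc] xa.
pose P y (g : O -> O) t := [/\ C t, x < t & forall z, z < y -> g z < t].
have [y g h t gh [Ct xt ht]|f fP] := @wfrec_choice O P \bot.
  by split => // z zy; rewrite -gh //; apply: ht.
have fX y : y < si -> P y f (f y).
  elim/oind: y => y ih ys; apply: fP.
  have [b ba hb] := bounded_below la (lt_trans ys sa)
    (fun z zy => Ca _ (let: And3 h _ _ := ih z zy (lt_trans zy ys) in h)).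
  have [t [Ct]] := Cu (Order.max x b) (eq_ind_r is_true (introT andP (conj xa ba)) (gt_max _ _ _)).
  rewrite gt_max => /andP[xt bt] _; exists t; split => // z zy; exact: lt_trans (hb z zy) bt.
have fm y z : y < z -> z < si -> f y < f z by move=> yz zs; have [_ _] := fX z zs; apply.
have fa y : y < si -> f y < al by move=> ys; apply: Ca; case: (fX y ys).
have [b ba hb] := bounded_below la sa fa.
have ub y : [set f z | z in below si] y -> y <= b by move=> [z zs <-]; apply/ltW/hb.
pose de := ord_sup [set f z | z in below si].
have fd y : y < si -> f y < de.
  move=> ys; have [y1 y2] := olim_succ ls ys.
  apply: lt_le_trans (fm _ _ y1 y2) _; apply: (ord_sup_ge ub); by exists (osucc y).
have dal : de < al by apply: le_lt_trans ba; exact: ord_sup_le.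
have xd : x < de by have [_ h _] := fX _ ls.1; apply: lt_trans h (fd _ ls.1).
have cd z : z < de -> exists2 y, y < si & z < f y.
  by move=> /(ord_sup_lt ub)[_ [y ys <-] zy]; exists y.
have d0 := le_lt_trans (bot_le x) xd.
have ld : olim de.
  split => // z /cd[y ys zy]; exists (f y); split => //; exact: fd.
exists de; split => //.
  apply: Cc => // z /cd[y ys zy]; exists (f y); split => //; last exact: fd.
  by case: (fX y ys).
apply/le_anti/andP; split.
  apply: (@cf_le_map _ _ f); split => // z /cd[y ys zy]; exists y => //; exact: ltW.
(* A shorter cofinal map [g] would have all its values below one [f y], as the indices needed to
   exceed them are bounded in the regular [si]. *)
rewrite leNgt; apply/negP => cds.
have [g [ga _ gc]] := cf_cofinal ld.
have h z : exists y, z < cf de -> y < si /\ g z < f y.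
  by case: (pselect (z < cf de)) => [/ga/cd[y]|]; [exists y|exists \bot].
have [k kP] := choice h.
have cds' : cf de < cf si by rewrite cs.
have [y ys hy] := bounded_below ls cds' (fun z zc => (kP z zc).1).
have [z zc yz] := gc _ (fd y ys); have [_ zk] := kP z zc.
have := fm _ _ (hy z zc) ys; rewrite ltNge; by rewrite (ltW (lt_trans yz zk)).
Qed.

(* [e y] is thin for all [nu >= cf y], and thinness is preserved by unions of
   length [nu]; this is what allows enlarging a C-sequence. *)
Definition thin nu X := forall g, nu < cf g -> exists2 e, e < g & forall x, X x -> x < g -> x <= e.

Lemma thin_sub nu X Y : Y `<=` X -> thin nu X -> thin nu Y.
Proof. by move=> YX tX g /tX[e eg h]; exists e => // x /YX; apply: h. Qed.

Lemma thin_bigcup nu (U : Type) (P : set U) (X : U -> set O) : \bot < nu ->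
  (forall g, nu < cf g -> small g P) -> (forall p, P p -> thin nu (X p)) ->
  thin nu [set x | exists2 p, P p & X p x].
Proof.
move=> n0 hs tX g ng.
have h p : exists e, P p -> e < g /\ forall x, X p x -> x < g -> x <= e.
  by case: (pselect (P p)) => [/tX/(_ g ng)[e eg ?]|]; [exists e|exists \bot].
have [k kP] := choice h.
have lg := cf_gt_lim n0 ng.
have [e eg he] := bounded_img lg (hs g ng) (fun p Pp => (kP p Pp).1).
exists e => // x [p Pp Xx] xg; apply: le_trans (ltW (he p Pp)); exact: (kP p Pp).2.
Qed.

Lemma thin_set1 nu y : \bot < nu -> thin nu [set y].
Proof.
move=> n0 g ng; have lg := cf_gt_lim n0 ng; case: (ltP y g) => yg.
  by exists y => // x ->.
by exists \bot => [|x -> /lt_geF]; [exact: lg.1|rewrite yg].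
Qed.

Lemma thin_img nu (U : Type) (P : set U) (f : U -> O) : \bot < nu ->
  (forall g, nu < cf g -> small g P) -> thin nu [set f p | p in P].
Proof.
move=> n0 hs; have := @thin_bigcup nu U P (fun p => [set f p]) n0 hs (fun p _ => thin_set1 (f p) n0).
by apply: thin_sub => _ [p Pp <-]; exists p.
Qed.

Lemma thin_setU nu X Y : \bot < nu -> thin nu X -> thin nu Y -> thin nu (X `|` Y).
Proof.
move=> n0 tX tY g ng; have [e eg he] := tX g ng; have [e' eg' he'] := tY g ng.
exists (Order.max e e'); first by rewrite gt_max eg eg'.
by move=> x [/he h /h|/he' h /h]; rewrite le_max => ->; rewrite ?orbT.
Qed.

(** * Successors of singular cardinals *)

Implicit Types (la ka th ch be ga ep i : O) (E : set O).

Definition succ_singular la ka := singular la /\ is_succ_cardinal la ka.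

Section Setting.
Variables la ka : O.
Hypothesis H : succ_singular la ka.

Lemma la_props : [/\ is_cardinal la, infinite_set (below la), olim la & cf la < la].
Proof. by have [[? ? ?] _] := H; split => //; apply: infinite_cardinal_lim. Qed.

Lemma la_lim : olim la. Proof. by case: la_props. Qed.

Lemma ka_props : [/\ la < ka, is_cardinal ka, infinite_set (below ka), regular ka &
      forall x, x < ka -> below x #<= below la].
Proof. by have [_ K] := H; have [_ ? _ _] := la_props; apply: succ_cardinal_props. Qed.

Lemma ka_lim : olim ka. Proof. by have [_ _ _ []] := ka_props. Qed.
Lemma la_ka : la < ka. Proof. by case: ka_props. Qed.
Lemma ka_reg : regular ka. Proof. by case: ka_props. Qed.
Lemma cf_ka : cf ka = ka. Proof. by case: ka_reg. Qed.
Lemma card_ka x : x < ka -> below x #<= below la.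
Proof. by have [_ _ _ _] := ka_props; apply. Qed.

Lemma ka_unc : uncountable_cf ka.
Proof.
have [_ ila _ _] := la_props; apply: (uncountable_cfP ila); rewrite cf_ka; exact: la_ka.
Qed.

Lemma small_ka x : x < ka -> small ka (below x).
Proof. by move=> xk; apply: small_below; [exact: ka_lim|rewrite cf_ka]. Qed.

Lemma not_card_ka : ~ (below ka #<= below la).
Proof. by have [_ [[]]] := H. Qed.

(** [cf y] is a regular cardinal of size at most [la], and [la] is singular. *)
Lemma cf_lt_la y : y < ka -> cf y < la.
Proof.
move=> yk; have [cl il ll cll] := la_props.
case: (pselect (olim y)) => [ly|nl]; last first.
  by rewrite ltNge; apply/negP => h; apply: nl; apply: (cf_gt_lim (cf_gt0 ll.1));
     apply: lt_le_trans cll h.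
rewrite ltNge; apply/negP => h.
have cy : cf y <= la.
  rewrite leNgt; apply/negP => ly'; have := cardinal_lt (cf_cardinal ly) ly'; apply.
  apply: card_le_trans (card_ka yk); exact: below_le (cf_le y).
have E : cf y = la by apply/le_anti; rewrite cy h.
by have := cf_cf ly; rewrite E => E'; move: cll; rewrite E' ltxx.
Qed.

(** The cardinal successor of [nu] is regular, hence different from the singular [la]. *)
Lemma next_regular nu : infinite_set (below nu) -> nu < la ->
  exists si, [/\ nu < si, si < la & regular si].
Proof.
move=> inu nl; have [cl il ll cll] := la_props.
have hl : card_lt (below nu) (below la) by split; [exact/below_le/ltW|exact: cardinal_lt].
have [si sP] := @ex_least (fun a => card_lt (below nu) (below a)) la hl.
have [ns _ _ rs _] := succ_cardinal_props inu sP.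
have sl : si <= la by have [_] := sP; apply.
exists si; split => //; rewrite lt_neqAle sl andbT; apply/eqP => E.
by have [_ E'] := rs; move: cll; rewrite -E E' ltxx.
Qed.

Lemma next_regular' nu : nu < la -> exists si, [/\ nu < si, si < la & regular si].
Proof.
move=> nl; have [cl il ll cll] := la_props.
have imu := lim_infinite (cf_lim ll).
have [|//|si [ns sl rs]] := @next_regular (Order.max nu (cf la)).
- by apply: infinite_le imu; rewrite le_max lexx orbT.
- by rewrite gt_max nl cll.
- by exists si; split => //; move: ns; rewrite gt_max => /andP[].
Qed.

Lemma point_cf_gt nu C x : nu < la -> club ka C -> x < ka ->
  exists ga, [/\ C ga, x < ga, ga < ka & nu < cf ga].
Proof.
move=> nl cC xk; have [si [ns sl rs]] := next_regular' nl.
have sk : si < cf ka by rewrite cf_ka; apply: lt_trans sl la_ka.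
have [de [? ? ? E]] := club_cof_point ka_lim rs sk cC xk.
by exists de; split => //; rewrite E.
Qed.

(** * Families of disjoint sets and the pressing-down criterion *)

Definition pwfam ch' (F : set (set O)) :=
  [/\ is_cardinal ch', forall A, F A -> A `<=` below ka /\ (A #= below ch'),
      F #= below ka & trivIset F id].

(** Otherwise every member has an element up to [y]; by disjointness these are distinct, and [ka]
    injects into the successor of [y]. *)
Lemma family_above ch' F y : pwfam ch' F -> y < ka ->
  exists2 B, F B & forall be, B be -> y < be.
Proof.
move=> [_ hF cF tF] yk; apply: contrapT => ne.
have h B : exists x, F B -> B x /\ x <= y.
  case: (pselect (F B)) => [FB|]; last by exists y.
  apply: contrapT => nx; apply: ne; exists B => // be Bbe.
  rewrite ltNge; apply/negP => bey; apply: nx; by exists be.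
have [k kP] := choice h; have [y1 y2] := olim_succ ka_lim yk.
apply: not_card_ka; apply: card_le_trans (card_ka y2).
rewrite -(card_le_eql cF); apply/(card_leE \bot); exists k; split => [B /kP[_ ky]|B B' FB FB' E].
  exact: le_lt_trans ky y1.
have [bk _] := kP B FB; have [bk' _] := kP B' FB'.
by apply: (tF B B' FB FB'); exists (k B); split => //=; rewrite E.
Qed.

Lemma family_nonempty ch' F B : pwfam ch' F -> F B -> B !=set0.
Proof.
move=> [_ hF cF tF] FB; apply: contrapT => /set0P/negP; rewrite negbK => /eqP B0.
have [_ _ ik _ _] := ka_props.
(* One empty member forces all members to be empty, so that [F] has at most one element. *)
have c0 : below ch' = set0.
  by have [_] := hF B FB; rewrite B0 card_eq_sym card_eq0 => /eqP.
apply: ik; rewrite -(eq_finite_set cF); apply: (sub_finite_set _ (finite_set1 set0)) => A /hF[_].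
by rewrite c0 card_eq0 => /eqP.
Qed.

Definition hits (c : O -> O -> O) F i := forall E, club ka E -> exists ga B e,
  [/\ E ga /\ ga < ka, F B, e < ga, forall be, B be -> ga < be &
      forall al be, e < al -> al < ga -> B be -> i < c al be].

Lemma hits_U_witness th ch c : ch <= la -> coloring ka th c ->
  (forall ch' F i, ch' < ch -> pwfam ch' F -> i < th -> hits c F i) ->
  U_witness ka ka th ch c.
Proof.
move=> chl cc hh; split => // ch' ch'c ch'ch F hF cF tF i ith.
have fF : pwfam ch' F by split.
have hi := hh ch' F i ch'ch fF ith.
pose good ga (p : set O * O) := [/\ F p.1, p.2 < ga, forall be, p.1 be -> ga < be &
      forall al be, p.2 < al -> al < ga -> p.1 be -> i < c al be].
have hg ga : exists p, (exists p, good ga p) -> good ga p.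
  by case: (pselect (exists p, good ga p)) => [[p gp]|ne]; [exists p|exists (set0, \bot)].
have [k kP] := choice hg.
pose Ga := [set ga | ga < ka /\ exists p, good ga p].
have sGa : stationary ka Ga.
  move=> E /hi[ga [B [e [[Ega gk] FB eg h1 h2]]]]; exists ga; split => //; split => //.
  by exists (B, e).
(* Pressing down gives stationarily many [ga] the same threshold [e0]. *)
have [e0 e0k] := @fodor ka Ga (fun ga => (k ga).2) ka_unc cf_ka sGa
  (fun ga h _ => let: And4 _ h _ _ := kP ga h.2 in h).
pose Ga' := Ga `&` [set ga | (k ga).2 = e0]; rewrite -/Ga' => sGa'.
have hb ga : exists y, Ga ga -> y < ka /\ forall be, (k ga).1 be -> be < y.
  case: (pselect (Ga ga)) => [[gk /kP[Fk _ _ _]]|]; last by exists \bot.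
  have [kb ke] := hF _ Fk.
  have sk : small ka (k ga).1.
    have chk : ch' < ka by apply: lt_trans la_ka; apply: lt_le_trans ch'ch chl.
    by apply: small_le (small_ka chk); move/card_eqPle: ke => [].
  by have [y yk hy] := bounded_img ka_lim sk (fun be h => kb be h); exists y.
have [bd bdP] := choice hb.
pose CC x : set O := [set z | z < ka /\ (Ga x -> bd x < z)].
have cCC x : x < ka -> club ka (CC x).
  move=> xk; case: (pselect (Ga x)) => [Gx|nG].
    have [bk _] := bdP x Gx.
    have := club_above ka_lim bk; congr club; apply/seteqP.
    by split => [z []//|z [zk h]]; split => //; apply: h.
  have := club_below ka_lim; congr club; apply/seteqP.
  by split => [z zk|z []//]; split.
pose D := [set g | g < ka /\ forall x, x < g -> CC x g].
have cD : club ka D := club_diag ka_unc cf_ka cCC.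
(* For [x < y] in [X], the set chosen at [x] lies between [e0] and [y], the one chosen at [y] lies
   above [y]; so all colours between them exceed [i]. *)
pose X := [set ga | [/\ Ga' ga, D ga & e0 < ga]].
have Xsub x y al be : X x -> X y -> x < y -> (k x).1 al -> (k y).1 be ->
    [/\ al < y, y < be, e0 < al & i < c al be].
  move=> [[Gx Ex] _ ex] [[Gy Ey] Dy ey] xy kal kbe.
  have [_ hbd] := bdP x Gx; have [_ hy] := Dy.2 x xy; have aly := lt_trans (hbd al kal) (hy Gx).
  have [_ _ hx _] := kP x Gx.2; have xal := hx _ kal.
  have [_ _ hy' hc] := kP y Gy.2; split => //; [exact: hy'|exact: lt_trans ex xal|].
  apply: hc => //; rewrite Ey; exact: lt_trans ex xal.
have Xne x : X x -> exists al, (k x).1 al.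
  by move=> [[[_ /kP[Fk _ _ _]] _] _ _]; exact: family_nonempty fF Fk.
exists [set (k x).1 | x in X]; split.
- by move=> _ [x [[[_ /kP[Fk _ _ _]] _] _ _] <-].
- apply: Cantor_Bernstein.
    rewrite -(card_le_eqr cF); apply: subset_card_le.
    by move=> _ [x [[[_ /kP[Fk _ _ _]] _] _ _] <-].
  apply: (@card_le_trans _ _ _ X).
    rewrite -{1}cf_ka; apply: cof_card ka_lim _ _ => [x [[[xk _] _] _]//|y yk].
    have my : Order.max y e0 < ka by rewrite gt_max yk e0k.
    have [x [[xm xk] [Dx Gx]]] := stationary_club ka_unc sGa' cD (club_above ka_lim my).
    by move: xm; rewrite gt_max => /andP[yx ex]; exists x => //; exact: ltW.
  apply/(card_leE set0); exists (fun x => (k x).1); split => [x Xx|x y Xx Xy E]; first by exists x.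
  have [al kal] := Xne x Xx.
  case: (ltgtP x y) => // xy; exfalso.
    have kal' : (k y).1 al by rewrite -E.
    have [h1 h2 _ _] := Xsub _ _ _ _ Xx Xy xy kal kal'; by have := lt_trans h1 h2; rewrite ltxx.
  have kal' : (k y).1 al by rewrite -E.
  have [h1 h2 _ _] := Xsub _ _ _ _ Xy Xx xy kal' kal; by have := lt_trans h1 h2; rewrite ltxx.
- move=> _ _ [x Xx <-] [y Xy <-] neq slt.
  have [al kal] := Xne x Xx; have [be kbe] := Xne y Xy.
  case: (ltgtP x y) => [xy|yx|E]; last by case: neq; rewrite E.
    set A := [set _ | _ in _ & _ in _].
    have Ac : A (c al be) by exists al => //; exists be.
    have [al' kal' [be' kbe' <-]] := least_mem Ac.
    by have [] := Xsub _ _ _ _ Xx Xy xy kal' kbe'.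
  have [h1 h2 _ _] := Xsub _ _ _ _ Xy Xx yx kbe kal.
  by have := lt_trans (lt_trans h1 h2) (slt _ _ kal kbe); rewrite ltxx.
Qed.

End Setting.

(** * Walks on ordinals *)

Lemma finite_small a (U : Type) (P : set U) : olim a -> finite_set P -> small a P.
Proof. by move=> la fP /card_le_finite/(_ fP); apply: lim_infinite (cf_lim la). Qed.

(** A C-sequence, with a bound on cardinality in place of order type. The weak inequality in the
    cofinality clause covers successors, whose set must contain the predecessor. *)
Definition cseq (e : O -> set O) := forall y,
  [/\ e y `<=` below y, forall x, x < y -> exists2 z, e y z & x <= z,
      forall g, \bot < g -> g < y -> cofin (e y) g -> e y g & e y #<= below (cf y)].

(** Enumerate by recursion the least point of [C] above all earlier values and above the earlier
    values of a cofinal map. Leastness makes the enumeration continuous, so its range is closed. *)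
Lemma thin_club y C : olim y -> club y C -> exists D, [/\ D `<=` C,
    forall x, x < y -> exists2 z, D z & x <= z,
    forall g, \bot < g -> g < y -> cofin D g -> D g & D #<= below (cf y)].
Proof.
move=> ly /clubP[Cs Cu Cc]; have lc := cf_lim ly.
have [f [fy fm fc]] := cf_cofinal ly.
pose Q x (g : O -> O) : set O := [set z | C z /\ forall w, w < x -> g w < z /\ f w < z].
have [x g h t gh [lt1 lt2]|k kP] := @wfrec_choice O (fun x (q : O -> O) t => is_least (Q x q) t) \bot.
  have E : Q x g = Q x h.
    apply/seteqP; split => z [Cz hz]; split => // w wx; have [? ?] := hz w wx; split => //.
      by rewrite -gh.
    by rewrite gh.
  by rewrite -E; split.
have hk x : x < cf y -> is_least (Q x k) (k x).
  elim/oind: x => x ih xc; apply: kP.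
  have hky w : w < x -> Order.max (k w) (f w) < y.
    move=> wx; have wc := lt_trans wx xc; rewrite gt_max fy // andbT.
    by have [[/Cs]] := ih w wx wc.
  have [b bb hb] := bounded_below ly xc hky.
  have [z [Cz bz _]] := Cu b bb; apply: (@ex_least (Q x k) z); split => // w /hb.
  by rewrite gt_max => /andP[? ?]; split; apply: lt_trans bz.
have km w x : w < x -> x < cf y -> k w < k x /\ f w < k x.
  by move=> wx xc; have [[_ h] _] := hk x xc; apply: h.
exists [set k x | x in below (cf y)]; split.
- by move=> _ [x xc <-]; have [[]] := hk x xc.
- move=> x xy; have [w wc xw] := fc x xy; have [w1 w2] := olim_succ lc wc.
  by exists (k (osucc w)); [exists (osucc w)|apply/ltW/(lt_trans xw); case: (km w (osucc w))].
- move=> g g0 gy cg.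
  have [w [[x xc E] _ wg]] := cg _ g0; rewrite -{w}E in wg.
  have [w0 [_ w0y gw0]] : exists w, [/\ w < cf y, w < cf y & g <= k w].
    have [w wc gw] := fc g gy; have [w1 w2] := olim_succ lc wc.
    by exists (osucc w); split => //; apply/ltW/(lt_trans gw); case: (km w (osucc w)).
  (* For the least [v] with [g <= k v], the limit [g] itself meets the conditions defining [k v], so
     [k v = g]. *)
  have [v [[vc gv] vl]] := @ex_least (fun w => w < cf y /\ g <= k w) w0 (conj w0y gw0).
  exists v => //; apply/le_anti; rewrite gv andbT; have [_] := hk v vc; apply.
  have hv u : u < v -> k u < g.
    by move=> uv; rewrite ltNge; apply/negP => gu; have := vl u (conj (lt_trans uv vc) gu);
      rewrite leNgt uv.
  split.
    apply: Cc => // u /cg[_ [[t tc <-] ut tg]]; exists (k t); split => //.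
    by have [[]] := hk t tc.
  move=> u uv; split; first exact: hv.
  have [_ [[t tc <-] ut tg]] := cg _ (hv u uv).
  have ult : u < t.
    rewrite ltNge; apply/negP; rewrite le_eqVlt => /orP[/eqP tu|tu].
      by move: ut; rewrite tu ltxx.
    have [h _] := km _ _ tu (lt_trans uv vc); by have := lt_trans h ut; rewrite ltxx.
  by have [_ h] := km _ _ ult tc; apply: lt_trans h tg.
- exact: card_image_le.
Qed.

Lemma ex_cseq (C : O -> set O) : (forall y, olim y -> club y (C y)) ->
  exists e, cseq e /\ forall y, olim y -> e y `<=` C y.
Proof.
move=> hC.
have h y : exists D, [/\ D `<=` below y, forall x, x < y -> exists2 z, D z & x <= z,
      forall g, \bot < g -> g < y -> cofin D g -> D g & D #<= below (cf y)]
      /\ (olim y -> D `<=` C y).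
  case: (pselect (olim y)) => [ly|nl].
    have [D [DC Du Dc Dk]] := thin_club ly (hC y ly); exists D; split => //; split => //.
    by move=> x /DC; have [h _ _] := hC y ly; apply: h.
  case: (eqVneq y \bot) => [->|/neq_bot_gt y0].
    exists set0; split => [|_ x []]; split => [x []|x|g _|]; [by rewrite ltx0|by rewrite ltx0|].
    by apply/(card_leE \bot); exists id; split.
  have [p py hp] := olimP y0 nl; exists [set p]; split => //; split => [_ ->//|x xy|g g0 gy cg|].
  - by exists p => //; apply: hp.
  - have [_ [-> _ pg]] := cg _ g0; by have := lt_le_trans pg (hp g gy); rewrite ltxx.
  - apply/(card_leE \bot); exists (fun=> \bot); split => [x _|x z -> ->//].
    exact: cf_gt0.
have [e eP] := choice h; exists e; split => y; by have [] := eP y.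
Qed.

Section Walk.
Variable e : O -> set O.
Hypothesis eP : cseq e.

Definition step al y := least [set z | e y z /\ al <= z].

Lemma stepP al y : al < y -> [/\ e y (step al y), al <= step al y & step al y < y].
Proof.
move=> ay; have [es eu _ _] := eP y; have [z ez az] := eu al ay.
have [h1 h2] := @least_mem [set z | e y z /\ al <= z] z (conj ez az); split => //.
exact: es h1.
Qed.

Lemma step_le al y z : e y z -> al <= z -> step al y <= z.
Proof. by move=> ez az; apply: least_le. Qed.

(* [tr al be y]: the walk from [be] down to [al] passes through [y]. *)
Inductive tr al : O -> O -> Prop :=
| tr_refl be : tr al be be
| tr_step be y : al < be -> tr al (step al be) y -> tr al be y.

Lemma tr_le al be y : tr al be y -> y <= be.
Proof.
elim=> // {}be {}y ab _ h; apply: (le_trans h); have [_ _ /ltW//] := stepP ab.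
Qed.

Lemma tr_finite al be : finite_set [set y | tr al be y].
Proof.
elim/oind: be => be ih; case: (ltP al be) => ab.
  have -> : [set y | tr al be y] = [set be] `|` [set y | tr al (step al be) y].
    apply/seteqP; split => y /=; last by case=> [->|h]; [exact: tr_refl|exact: tr_step].
    by case=> [be'|be' y' _]; [left|right].
  rewrite finite_setU; split; first exact: finite_set1.
  by apply: ih; case: (stepP ab).
apply: (sub_finite_set _ (finite_set1 be)) => y /= t.
by case: t ab => // be' y' h _; rewrite leNgt h.
Qed.

(** While [e be] is bounded below [de], every [al] between that bound and [de] has the same first
    step as [de]. The descent stops at [D] when [de] is reached or [e D] accumulates at [de]. *)
Lemma walk de be : olim de -> de < be -> exists D ep, [/\ ep < de,
   forall al, ep < al -> al < de -> tr al be D, D <= be &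
   D = de \/ [/\ de < D, e D de & cofin (e D) de]].
Proof.
move=> ld; elim/oind: be => be ih db.
have [es eu ec _] := eP be.
case: (pselect (cofin (e be) de)) => [c|/not_cofin[e1 e1d h1]].
  exists be, \bot; split => //; [exact: ld.1|by move=> *; exact: tr_refl|].
  by right; split => //; apply: ec => //; exact: ld.1.
have [ez dz zb] := stepP db; set z := step de be in ez dz zb.
have st al : e1 < al -> al < de -> step al be = z.
  move=> ea ad; have [ew aw wb] := stepP (lt_trans ad db).
  apply/le_anti; rewrite step_le //=; last by apply: le_trans dz; exact: ltW.
  apply: step_le => //; rewrite leNgt; apply/negP => wd.
  by have := lt_le_trans ea (le_trans aw (h1 _ ew wd)); rewrite ltxx.
move: dz; rewrite le_eqVlt => /orP[/eqP dz|dz].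
  exists z, e1; split => //; [|exact: ltW|by left].
  by move=> al ea ad; apply: tr_step; [exact: lt_trans db|rewrite st //; exact: tr_refl].
have [D [ep [epd ht Dz hD]]] := ih z zb dz.
exists D, (Order.max e1 ep); split => //; first by rewrite gt_max e1d epd.
  move=> al; rewrite gt_max => /andP[ea epa] ad; apply: tr_step; first exact: lt_trans db.
  by rewrite st //; apply: ht.
exact: le_trans Dz (ltW zb).
Qed.

End Walk.

(** * Club guessing along walks *)

Implicit Types (nu v w : O).

(** If [cf a > si] all values are bounded. If [cf a < si] and no bound works, regularity of [si]
    gives one point of [Z] whose value exceeds a cofinal subset of [a]. *)
Lemma pigeon si a (f : O -> O) (Z : set O) : regular si -> olim a -> cf a <> si ->
  (forall x, x < si -> exists y, [/\ Z y, x <= y & y < si]) -> (forall x, x < si -> f x < a) ->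
  exists2 b, b < a & forall x, x < si -> exists y, [/\ Z y, x <= y, y < si & f y <= b].
Proof.
move=> [ls cs] la ne Zu fa.
case: (ltgtP (cf a) si) => [lt|gt|//]; last first.
  have [b ba hb] := bounded_below la gt fa; exists b => // x /Zu[y [Zy xy ys]].
  by exists y; split => //; exact/ltW/hb.
apply: contrapT => nb.
have [k [ka km kc]] := cf_cofinal la.
have h z : exists x, z < cf a -> x < si /\ forall y, Z y -> x <= y -> y < si -> k z < f y.
  case: (pselect (z < cf a)) => [zc|]; last by exists \bot.
  apply: contrapT => nx; apply: nb; exists (k z); first exact: ka.
  move=> x xs; apply: contrapT => ny; apply: nx; exists x => _; split => // y Zy xy ys.
  by rewrite ltNge; apply/negP => fk; apply: ny; exists y.
have [b bP] := choice h.
have lt' : cf a < cf si by rewrite cs.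
have [t ts ht] := bounded_below ls lt' (fun z zc => (bP z zc).1).
have [y [Zy ty ys]] := Zu t ts; have [z zc fz] := kc _ (fa y ys).
have := (bP z zc).2 y Zy (le_trans (ltW (ht z zc)) ty) ys; by rewrite ltNge (ltW fz).
Qed.

(** Induction on a bound [v] of the values: those below [v] are bounded by the value at the first
    argument where [f] drops below [v]. *)
Lemma antitone_finite A (f : O -> O) : (forall s t, A s -> A t -> s <= t -> f t <= f s) ->
  finite_set [set f s | s in A].
Proof.
suff h v : forall A, (forall s t, A s -> A t -> s <= t -> f t <= f s) ->
    (forall s, A s -> f s <= v) -> finite_set [set f s | s in A].
  move=> fA; case: (pselect (A !=set0)) => [[x Ax]|A0]; last first.
    by apply: (sub_finite_set _ (finite_set0 O)) => y [s As _]; case: A0; exists s.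
  have [m [Am ml]] := ex_least Ax.
  by apply: (h (f m)) => // s As; apply: fA => //; apply: ml.
elim/oind: v => v ih {}A fA Av.
pose A' := [set s | A s /\ f s < v].
have fin' : finite_set [set f s | s in A'].
  case: (pselect (A' !=set0)) => [[x A'x]|A0]; last first.
    by apply: (sub_finite_set _ (finite_set0 O)) => y [s As _]; case: A0; exists s.
  have [m [[Am mv] ml]] := ex_least A'x.
  apply: (ih _ mv) => [s t [As _] [At _]|s A's]; first exact: fA.
  by case: (A's) => As _; apply: fA => //; apply: ml.
apply: (@sub_finite_set _ _ ([set v] `|` [set f s | s in A'])).
  move=> _ [s As <-]; have := Av s As; rewrite le_eqVlt => /orP[/eqP->|sv]; first by left.
  by right; exists s.
by rewrite finite_setU; split => //; exact: finite_set1.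
Qed.

(** The largest point of a club [E] not above [z]; the value is [\bot] when [E] has no point up to
    [z]. *)
Definition dropto (E : set O) z := ord_sup (E `&` [set x | x <= z]).

Lemma drop_le E z : dropto E z <= z.
Proof. by apply: ord_sup_le => x []. Qed.

Lemma drop_ge E z x : E x -> x <= z -> x <= dropto E z.
Proof. by move=> Ex xz; apply: (@ord_sup_ge _ z) => // y []. Qed.

Lemma drop_sub (E E' : set O) z : E `<=` E' -> dropto E z <= dropto E' z.
Proof. by move=> EE; apply: ord_sup_le => x [/EE Ex xz]; apply: drop_ge. Qed.

Lemma drop_mem ka (E : set O) z x : club ka E -> E x -> x <= z -> z < ka -> E (dropto E z).
Proof.
move=> /clubP[_ _ Ec] Ex xz zk; apply: contrapT => nd; have nd0 := nd.
have xd := drop_ge Ex xz.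
have xd' : x < dropto E z by rewrite lt_neqAle xd andbT; apply/eqP => E'; apply: nd; rewrite -E'.
apply: nd0; apply: Ec.
- exact: le_lt_trans (bot_le x) xd'.
- exact: le_lt_trans (drop_le E z) zk.
move=> w /(@ord_sup_lt _ z)[y []//|y [Ey yz] wy]; exists y; split => //.
rewrite lt_neqAle drop_ge // andbT; apply/eqP => E'; apply: nd; by rewrite -E'.
Qed.

(** * Reachable points and the guessing lemma *)

Section Engine.
Variables (la ka rho : O) (e : O -> set O).
Hypotheses (H : succ_singular la ka) (eP : cseq e).
Hypotheses (rr : regular rho) (mur : cf la < rho) (rl : rho < la).

Section Reach.
Variable E : set O.

(** Each of the [n] moves follows the C-sequence and drops to [E]. Moving only from points of
    cofinality at most [nu] keeps the reached set thin. *)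
Fixpoint reachn nu n y : set O :=
  if n is n'.+1 then [set z | cf y <= nu /\ exists2 x, e y x & reachn nu n' (dropto E x) z]
  else [set y].

Definition reach nu y : set O := [set z | exists n, reachn nu n y z].

Lemma reach_step nu y z x : reach nu y z -> cf z <= nu -> e z x -> reach nu y (dropto E x).
Proof.
move=> [n]; elim: n y => [|n ih] y /=; first by move=> -> cz ez; exists 1%N; split => //; exists x.
move=> [cy [w ew rw]] cz ez; have [m rm] := ih _ rw cz ez.
by exists m.+1; split => //; exists w.
Qed.

Lemma reach_mono nu nu' y : nu <= nu' -> reach nu y `<=` reach nu' y.
Proof.
move=> nn z [n]; elim: n y => [|n ih] y /=; first by move=> ->; exists 0%N.
move=> [cy [x ex /ih[m rm]]]; exists m.+1; split; first exact: le_trans nn.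
by exists x.
Qed.

(** Each move is a union over at most [nu] indices and there are countably many stages, both fewer
    than [cf g] when [nu < cf g]. *)
Lemma reach_thin nu y : infinite_set (below nu) -> thin nu (reach nu y).
Proof.
move=> inu; have n0 := infinite_pos inu.
have hn n : thin nu (reachn nu n y).
  elim: n y => [|n ih] y /=; first exact: thin_set1.
  case: (leP (cf y) nu) => cy; last by move=> g ng; exists \bot => [|x [] //]; case: (cf_gt_lim n0 ng).
  apply: thin_sub (@thin_bigcup nu O (e y) (fun x => reachn nu n (dropto E x)) n0 _ _).
  - by move=> x [_ [w ew rw]]; exists w.
  - move=> g ng; have [_ _ _ ek] := eP y; have lg := cf_gt_lim n0 ng.
    exact: small_card_le lg (le_lt_trans cy ng) ek.
  - by move=> x _; exact: ih.
apply: thin_sub (@thin_bigcup nu nat setT (fun n => reachn nu n y) n0 _ _) => //.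
- by move=> z [n rn]; exists n.
- move=> g ng; exact: small_card_le (cf_gt_lim n0 ng) ng (iffLR (infiniteP _) inu).
Qed.

(* Contains the reach of every [x] in [e y]: if the walk towards [de] stops at [D]
   with [de] in [e D], then the points reached from [de] lie in [enu nu D]. *)
Definition enu nu y : set O :=
  e y `|` (reach nu y `|` [set z | exists2 x, e y x & reach nu x z]).

Lemma enu_mono nu nu' y : nu <= nu' -> enu nu y `<=` enu nu' y.
Proof.
move=> nn z [ez|[rz|[x ex rz]]]; [by left|by right; left; exact: reach_mono rz|].
by right; right; exists x => //; exact: reach_mono rz.
Qed.

Lemma enu_thin nu y : infinite_set (below nu) -> cf y <= nu -> thin nu (enu nu y).
Proof.
move=> inu cy; have n0 := infinite_pos inu; have [_ _ _ ek] := eP y.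
have sm g : nu < cf g -> small g (e y).
  by move=> ng; exact: small_card_le (cf_gt_lim n0 ng) (le_lt_trans cy ng) ek.
apply: (thin_setU n0); last apply: (thin_setU n0 (reach_thin _ inu)).
  by have := thin_img id n0 sm; rewrite image_id.
by apply: thin_bigcup => // x _; exact: reach_thin.
Qed.

Definition stp nu y al := least [set z | enu nu y z /\ al <= z].

Lemma stpP nu y al : al < y -> [/\ enu nu y (stp nu y al), al <= stp nu y al & stp nu y al < y].
Proof.
move=> ay; have [es eu _ _] := eP y; have [z ez az] := eu al ay.
have hz : [set z | enu nu y z /\ al <= z] z by split => //; left.
have [h1 h2] := least_mem hz; split => //; apply: le_lt_trans (least_le hz) _; exact: es.
Qed.

Definition pts al be : set O := [set m | exists y nu,
  [/\ tr e al be y, al < y, nu < la, m = stp nu y al & al < m]].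

Lemma pts_bound al be m : pts al be m -> al < m /\ m < be.
Proof.
move=> [y [nu [t ay nl -> am]]]; split => //; have [_ _ h] := stpP nu ay.
exact: lt_le_trans h (tr_le eP t).
Qed.

(* As [nu] grows, [stp nu y al] decreases, so it takes finitely many values. *)
Lemma pts_finite al be : finite_set (pts al be).
Proof.
apply: (@sub_finite_set _ _ (\bigcup_(y in [set y | tr e al be y /\ al < y])
          [set stp nu y al | nu in below la])).
  by move=> m [y [nu [t ay nl -> am]]]; exists y => //; exists nu.
apply: bigcup_finite.
  by apply: sub_finite_set (tr_finite eP al be) => y [].
move=> y [t ay]; apply: antitone_finite => s s' sl sl' ss.
have [h1 h2 _] := stpP s ay; apply: least_le; split => //; exact: enu_mono h1.
Qed.

(** Since [B] is smaller than [cf la], one [eta < de] serves as threshold for all walks towards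
    [de], and one bound below [la] covers the cofinalities of their stopping points. When
    [cf ga > nu], the enlarged sets at these points are bounded below [ga], so [ga] is their next
    element above every [al] near [ga]. *)
Lemma common_point ch' B de : olim de -> de < ka -> cf de = rho -> ch' < cf la ->
  B #<= below ch' -> (forall be, B be -> de < be /\ be < ka) ->
  exists nu0 eta, [/\ nu0 < la, eta < de & forall nu ga, nu0 <= nu -> nu < la ->
    reach nu de ga -> eta < ga -> ga < de -> nu < cf ga ->
    exists2 ep, ep < ga & forall be al, B be -> ep < al -> al < ga -> pts al be ga].
Proof.
move=> ld dk cd chm Bc hB.
have h be : exists p : O * O, B be -> [/\ p.2 < de,
     forall al, p.2 < al -> al < de -> tr e al be p.1, p.1 <= be &
     p.1 = de \/ [/\ de < p.1, e p.1 de & cofin (e p.1) de]].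
  case: (pselect (B be)) => [/hB[db bk]|]; last by exists (de, de).
  by have [D [ep hh]] := walk eP ld db; exists (D, ep).
have [k kP] := choice h.
have ll := la_lim H.
have sl : small la B by exact: small_card_le ll chm Bc.
have cl be : B be -> cf (k be).1 < la.
  move=> Bb; apply: (cf_lt_la H); have [_ _ h1 _] := kP be Bb; have [_ h2] := hB be Bb.
  exact: le_lt_trans h1 h2.
have [nu1 n1l hn1] := bounded_img ll sl cl.
have sd : small de B by apply: (small_card_le ld) Bc; rewrite cd; exact: lt_trans mur.
have [eta ed he] := @bounded_img _ _ B (fun be => (k be).2) ld sd (fun be Bb => let: And4 h _ _ _ := kP be Bb in h).
exists (Order.max nu1 rho), eta; split => //; first by rewrite gt_max n1l rl.
move=> nu ga; rewrite ge_max => /andP[n1 rn] nl rg eg gd ng.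
have inu : infinite_set (below nu) by apply: infinite_le rn (lim_infinite rr.1).
have lg := cf_gt_lim (infinite_pos inu) ng.
have h' be : exists ep, B be -> ep < ga /\ forall x, enu nu (k be).1 x -> x < ga -> x <= ep.
  case: (pselect (B be)) => [Bb|]; last by exists \bot.
  have [ep ? ?] := enu_thin inu (le_trans (ltW (hn1 be Bb)) n1) ng.
  by exists ep.
have [ep epP] := choice h'.
have sg : small ga B.
  by apply: (small_card_le lg) Bc; apply: lt_trans ng; apply: lt_le_trans rn; exact: lt_trans mur.
have [ep0 e0g he0] := bounded_img lg sg (fun be Bb => (epP be Bb).1).
exists (Order.max ep0 eta); first by rewrite gt_max e0g eg.
move=> be al Bb; rewrite gt_max => /andP[e0a ea] ag.
have [h1 h2 h3 h4] := kP be Bb.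
have dD : de <= (k be).1 by case: h4 => [->//|[/ltW]].
have aD : al < (k be).1 by apply: lt_le_trans dD; apply: lt_trans gd.
exists (k be).1, nu; split => //; first by apply: h2; [exact: lt_trans (he _ Bb) ea|exact: lt_trans gd].
(* Either the walk stops at [de], and [ga] is reached from it, or [de] is in the C-set of the
   stopping point; the enlargement covers both cases. *)
have hg : enu nu (k be).1 ga.
  by case: h4 => [E'|[_ eD _]]; right; [left; rewrite E'|right; exists de].
apply/esym/leastE; split; first by split => //; exact: ltW.
move=> z [ez az]; rewrite leNgt; apply/negP => zg.
have := (epP be Bb).2 z ez zg; rewrite leNgt; by rewrite (lt_trans (he0 be Bb) (lt_le_trans e0a az)).
Qed.

(** The sets that are guessed: positive sets of an ideal depending on [E]. *)
Definition pos X := forall E', club ka E' -> exists de, [/\ E' de, de < ka, cf de = rho &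
  forall nu0 eta, nu0 < la -> eta < de -> exists nu ga,
   [/\ nu0 <= nu < la, reach nu de ga, E' ga /\ X ga, eta < ga < de & nu < cf ga]].

End Reach.

(* If no club works, iterate [L] times the clubs refuting each other.  The points
   [dropto] of a fixed ordinal to the iterates decrease, hence are eventually
   constant, so a single walk down from a suitable [de] is followed by almost all
   iterates; it ends in a point of all the clubs, which one of them refutes. *)
Lemma guess L : regular L -> cf la < L -> L < rho -> exists2 E, club ka E & pos E setT.
Proof.
move=> rL muL Lr; have lk := ka_lim H; have uk := ka_unc H; have ck := cf_ka H; have ll := la_lim H.
have lak := la_ka H; have rk : rho < ka := lt_trans rl lak.
apply: contrapT => ne.
pose refutes (E E' : set O) := club ka E' /\ forall de, E' de -> de < ka -> cf de = rho ->
  exists p : O * O, [/\ p.1 < la, p.2 < de & forall nu ga, p.1 <= nu -> nu < la -> reach E nu de ga ->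
     E' ga -> p.2 < ga -> ga < de -> cf ga <= nu].
have hR E : exists E', club ka E -> refutes E E'.
  case: (pselect (club ka E)) => [cE|]; last by exists setT.
  have : ~ pos E setT by move=> pE; apply: ne; exists E.
  move=> /existsNP[E' /not_implyP[cE' nE']]; exists E' => _; split => // de Ed dk cd.
  apply: contrapT => np; apply: nE'; exists de; split => // nu0 eta n0 ed.
  apply: contrapT => np2; apply: np; exists (nu0, eta); split => // nu ga /= n1 n2 rg Eg eg gd.
  rewrite leNgt; apply/negP => ng; apply: np2; exists nu, ga; split => //; apply/andP; by split.
have [R RP] := choice hR.
(* A decreasing sequence of clubs, each contained in the refutations of all earlier ones. *)
have [x q h t qh ->|Ex ExP] := @wfrec_choice (set O)
   (fun x (q : O -> set O) t => t = [set z | z < ka /\ forall w, w < x -> R (q w) z]) setT.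
  apply/seteqP; split => z [zk hz]; split => // w wx; [rewrite -qh|rewrite qh] => //; exact: hz.
have {}ExP x : Ex x = [set z | z < ka /\ forall w, w < x -> R (Ex w) z].
  by apply: ExP; eexists.
have Exc x : x < ka -> club ka (Ex x).
  elim/oind: x => x ih xk; rewrite ExP; apply: (@club_bigcap ka O (below x) (fun w => R (Ex w)) uk (small_ka H xk)).
  by move=> w wx; have [] := RP _ (ih w wx (lt_trans wx xk)).
have Exm w x : w <= x -> Ex x `<=` Ex w.
  move=> wx z; rewrite ExP => -[zk hz]; rewrite ExP; split => // v vw; apply: hz.
  exact: lt_le_trans vw wx.
have ExR w x : w < x -> Ex x `<=` R (Ex w).
  by move=> wx z; rewrite ExP => -[_]; apply.
have Lk : L < ka := lt_trans Lr rk.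
(* [de] is taken of cofinality [rho] and a limit of every [Z nu], so that a point [ga0] of all the
   clubs with large cofinality is available as a floor for the descent. *)
pose Z nu := [set z | Ex L z /\ nu < cf z].
have cZ nu : below la nu -> club ka [set g | [/\ \bot < g, g < ka & cofin (Z nu) g]].
  move=> nl; apply: club_acc => // x xk.
  by have [ga [? ? ? ?]] := point_cf_gt H nl (Exc _ Lk) xk; exists ga.
have cD := club_setI uk (Exc _ Lk) (club_bigcap uk (small_ka H lak) cZ).
have rk' : rho < cf ka by rewrite ck.
have [de [[Ede [dk hde]] _ _ cd]] := club_cof_point lk rr rk' cD (lt_trans (infinite_pos (lim_infinite rr.1)) rk).
have ld : olim de by apply: (cf_gt_lim (cf_gt0 ll.1)); rewrite cd.
have hp x : exists p : O * O, x < L -> [/\ p.1 < la, p.2 < de & forall nu ga, p.1 <= nu ->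
     nu < la -> reach (Ex x) nu de ga -> R (Ex x) ga -> p.2 < ga -> ga < de -> cf ga <= nu].
  case: (pselect (x < L)) => [xL|]; last by exists (\bot, \bot).
  have [_ /(_ de (ExR _ _ xL _ Ede) dk cd)[p hp]] := RP _ (Exc x (lt_trans xL Lk)).
  by exists p.
have [p pP] := choice hp.
(* The [L] thresholds below [de] have a common bound since [L < cf de]. Those below [la] have one
   only for unboundedly many indices, by [pigeon]. *)
have [eta ed he] := @bounded_below de L (fun x => (p x).2) ld (eq_ind_r (fun z => L < z) Lr cd)
   (fun x xL => let: And3 _ h _ := pP x xL in h).
have cfne : cf la <> L by move=> E; move: muL; rewrite E ltxx.
have LL x : x < L -> exists y, [/\ setT y, x <= y & y < L] by exists x.
have [nu1 n1l hn1] := @pigeon L la (fun x => (p x).1) setT rL ll cfne LL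
   (fun x xL => let: And3 h _ _ := pP x xL in h).
pose nu := Order.max nu1 rho.
have nl : nu < la by rewrite gt_max n1l rl.
have n1n : nu1 <= nu by rewrite le_max lexx.
have rn : rho <= nu by rewrite le_max lexx orbT.
have [_ _ /(_ eta ed)[ga0 [[Eg0 cg0] eg0 g0d]]] := hde nu nl.
(* The descent stays in [Ex L] after leaving [de], is followed by all late clubs, and stops at
   cofinality above [nu], at [ga0] at the latest. *)
have hw v : ga0 <= v -> v <= de -> v = de \/ Ex L v ->
   (exists2 x0, x0 < L & forall x, x0 <= x -> x < L -> reach (Ex x) nu de v) ->
   exists w, [/\ ga0 <= w, w < de, nu < cf w, Ex L w &
     exists2 x0, x0 < L & forall x, x0 <= x -> x < L -> reach (Ex x) nu de w].
  elim/oind: v => v ih gv vd hv [x0 x0L hx0].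
  case: (ltP nu (cf v)) => cv.
    have nd : v <> de by move=> E; move: cv; rewrite E cd ltNge rn.
    exists v; split => //; [by rewrite lt_neqAle vd andbT; apply/eqP|by case: hv|by exists x0].
  have g0v : ga0 < v.
    by rewrite lt_neqAle gv andbT; apply/eqP => E; move: cv; rewrite -E leNgt cg0.
  have [ez gz zv] := stepP eP g0v; set z := step e ga0 v in ez gz zv.
  (* [f] is nonincreasing, hence constant from the place [x1] where it is least; its final value
     lies in all the clubs. *)
  pose f x := dropto (Ex x) z.
  pose V := [set y | exists x, [/\ x0 <= x, x < L & f x = y]].
  have [v' [[x1 [x01 x1L fx1]] vl]] : exists y, is_least V y.
    by apply: (@ex_least V (f x0)); exists x0.
  have fE x : x1 <= x -> x < L -> f x = v'.
    move=> xx xL; apply/le_anti/andP; split; last by apply: vl; exists x; split => //; exact: le_trans xx.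
    rewrite -fx1; apply: drop_sub; exact: Exm.
  have zk : z < ka by apply: lt_trans dk; apply: lt_le_trans vd.
  have gv' x : x <= L -> Ex x ga0 by move=> xL; apply: Exm Eg0.
  have ExLv' : Ex L v'.
    rewrite ExP; split => [|w wL].
      by rewrite -fx1; apply: le_lt_trans (drop_le _ _) zk.
    have [w1 w2] := olim_succ rL.1 wL.
    pose x := Order.max x1 (osucc w).
    have xL : x < L by rewrite gt_max x1L w2.
    rewrite -(fE x) // ?le_max ?lexx //; apply: (@ExR w x).
      by apply: lt_le_trans w1 _; rewrite le_max lexx orbT.
    apply: drop_mem zk; [exact: Exc (lt_trans xL Lk)|apply: gv'; exact: ltW|exact: gz].
  have v'z : v' <= z by rewrite -fx1; exact: drop_le.
  apply: (ih v') => //; first exact: le_lt_trans v'z zv.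
  - rewrite -fx1; apply: drop_ge gz; apply: gv'; exact: ltW.
  - exact: le_trans v'z (le_trans (ltW zv) vd).
  - by right.
  exists x1 => // x xx xL; rewrite -(fE x) //.
  apply: (@reach_step _ nu de v z) => //; apply: hx0 => //; exact: le_trans xx.
have h0 : exists2 x0, x0 < L & forall x, x0 <= x -> x < L -> reach (Ex x) nu de de.
  by exists \bot; [exact: rL.1.1|move=> x _ _; exists 0%N].
have [w [gw wd cw Ew [x0 x0L hx0]]] := hw de (ltW g0d) (lexx de) (or_introl erefl) h0.
(* Among the late clubs there is one whose threshold is at most [nu1]; its refutation excludes
   [w]. *)
have [x [_ x0x xL nux]] := hn1 x0 x0L.
have [_ _ /(_ nu w)] := pP x xL.
rewrite (le_trans nux n1n) => /(_ isT nl (hx0 x x0x xL) (ExR _ _ xL _ Ew)).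
rewrite (lt_le_trans (lt_trans (he x xL) eg0) gw) => /(_ isT wd); by rewrite leNgt cw.
Qed.

End Engine.

(** * Transfer principles *)

Implicit Types (t : O).

Lemma sup_finite_lt A th : olim th -> finite_set A -> (forall x, A x -> x < th) -> ord_sup A < th.
Proof.
move=> lt fA Ath; have [y yt hy] := bounded_img lt (finite_small lt fA) Ath.
by apply: le_lt_trans yt; apply: ord_sup_le => x /hy/ltW.
Qed.

Lemma sup_finite_ge A th x : olim th -> finite_set A -> (forall x, A x -> x < th) -> A x ->
  x <= ord_sup A.
Proof.
move=> lt fA Ath; have [y yt hy] := bounded_img lt (finite_small lt fA) Ath.
by apply: (@ord_sup_ge _ y) => z /hy/ltW.
Qed.

(** Compose the coloring with a monotone cofinal map from [cf th] to [th]. *)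
Lemma U_lift_cf ka th ch : olim th -> U_principle ka ka (cf th) ch -> U_principle ka ka th ch.
Proof.
move=> lt [c [cc hc]]; have [f [ft fm fc]] := cf_cofinal lt.
exists (fun al be => f (c al be)); split; first by move=> al be ab bk; apply/ft/cc.
move=> ch' ch'c ch'l F hF cF tF i /fc[x xc ix].
have [G [GF cG hG]] := hc ch' ch'c ch'l F hF cF tF x xc.
exists G; split => // A B GA GB neq slt; have xl := hG A B GA GB neq slt.
(* The least element of the empty set is [\bot], which cannot exceed [x]. *)
have [u [v [Au Bv]]] : exists u v, A u /\ B v.
  apply: contrapT => ne; move: xl; rewrite /least xgetPN ?ltx0 // => z [[u Au [v Bv _]] _].
  by apply: ne; exists u, v.
pose L := [set f (c al be) | al in A & be in B]; rewrite -/L.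
have Lm : L (f (c u v)) by exists u => //; exists v.
have [al Aal [be Bbe <-]] := least_mem Lm.
have cl : x < c al be by apply: lt_le_trans xl _; apply: least_le; exists al => //; exists be.
apply: lt_le_trans ix _; apply: fm; first exact: ltW.
by apply: cc; [exact: slt|case: (hF B (GF _ GB)) => h _; exact: h].
Qed.

Section Principles.
Variables (la ka : O).
Hypothesis (H : succ_singular la ka).

Definition hitting th (c : O -> O -> O) := forall S i C, stationary ka S -> i < th -> club ka C ->
  exists t ga ep, [/\ C t, S ga /\ ga < ka, ep < t, t < ga &
     forall al, ep < al -> al < t -> i < c al ga].

Section PosHit.
Variables (rho : O) (e : O -> set O) (E : set O).
Hypotheses (eP : cseq e) (rr : regular rho) (mur : cf la < rho) (rl : rho < la).

Lemma pos_hit X ch' F C : pos la ka rho e E X -> ch' < cf la -> pwfam ka ch' F -> club ka C ->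
  exists ga B ep, [/\ [/\ C ga, X ga & ga < ka], F B, ep < ga, forall be, B be -> ga < be &
    forall be al, B be -> ep < al -> al < ga -> pts la e E al be ga].
Proof.
move=> pX chl fF /pX[de [Cd dk cd hde]].
have [B FB hB] := family_above H fF dk.
have [_ hF _ _] := fF; have [Bk /card_eqPle[Bc _]] := hF B FB.
have ld : olim de by apply: (cf_gt_lim (cf_gt0 (la_lim H).1)); rewrite cd.
have [nu0 [eta [n0 ed hce]]] := common_point H eP rr mur rl E ld dk cd chl Bc
  (fun be Bb => conj (hB be Bb) (Bk be Bb)).
have [nu [ga [/andP[n1 n2] rg [Cg Xg] /andP[eg gd] ng]]] := hde nu0 eta n0 ed.
have [ep epg hp] := hce nu ga n1 n2 rg eg gd ng.
exists ga, B, ep; split => //; first by split => //; exact: lt_trans gd dk.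
by move=> be /hB; exact: lt_trans gd.
Qed.

Lemma pos_U th (h : O -> O) : olim th -> (forall x, h x < th) ->
  (forall i, i < th -> pos la ka rho e E [set ga | i < h ga]) ->
  U_principle ka ka th (cf la).
Proof.
move=> lt hth hpos; pose V al be := [set h m | m in pts la e E al be].
have fV al be : finite_set (V al be) by apply: finite_image; exact: pts_finite.
have Vt al be x : V al be x -> x < th by move=> [m _ <-].
exists (fun al be => ord_sup (V al be)).
apply: (hits_U_witness H) => [|al be _ _|ch' F i chl fF it C cC].
- exact: cf_le.
- exact: sup_finite_lt lt (fV al be) (@Vt al be).
- have [ga [B [ep [[Cg Xg gk] FB epg gB hp]]]] := pos_hit (hpos i it) chl fF cC.
  exists ga, B, ep; split => // al be ea ag Bb; apply: lt_le_trans Xg _.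
  apply: (sup_finite_ge lt (fV al be) (@Vt al be)); exists ga => //; exact: hp.
Qed.

Lemma hitting_pos_U th c : olim th -> pos la ka rho e E setT -> coloring ka th c -> hitting th c ->
  U_principle ka ka th (cf la).
Proof.
move=> lt pT cc hit; pose V al be := [set c al m | m in pts la e E al be].
have fV al be : finite_set (V al be) by apply: finite_image; exact: pts_finite.
have Vt al be : be < ka -> forall x, V al be x -> x < th.
  move=> bk x [m /(pts_bound eP)[am mb] <-]; apply: cc => //; exact: lt_trans bk.
exists (fun al be => ord_sup (V al be)).
apply: (hits_U_witness H) => [|al be ab bk|ch' F i chl fF it C cC].
- exact: cf_le.
- exact: sup_finite_lt lt (fV al be) (Vt al be bk).
pose good ga (p : set O * O) := [/\ F p.1, p.2 < ga, forall be, p.1 be -> ga < be &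
   forall be al, p.1 be -> p.2 < al -> al < ga -> pts la e E al be ga].
have hg ga : exists p, (exists p, good ga p) -> good ga p.
  by case: (pselect (exists p, good ga p)) => [[p gp]|ne]; [exists p|exists (set0, \bot)].
have [k kP] := choice hg.
pose S := [set ga | ga < ka /\ exists p, good ga p].
have sS : stationary ka S.
  move=> D cD; have [ga [B [ep [[Dg _ gk] FB epg gB hp]]]] := pos_hit pT chl fF cD.
  by exists ga; split => //; split => //; exists (B, ep).
have [e0 e0k sS'] := @fodor ka S (fun ga => (k ga).2) (ka_unc H) (cf_ka H) sS
  (fun ga h _ => let: And4 _ h _ _ := kP ga h.2 in h).
have cC' := club_setI (ka_unc H) cC (club_above (ka_lim H) e0k).
(* The club point [t] replaces the guessed [ga]: for [al] near [t], [ga] is still in [pts al be],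
   and [c al ga] exceeds [i]. *)
have [t [ga [ep [[Ct [e0t tk]] [[Sg Eg] gk] ept tg hc]]]] := hit _ i _ sS' it cC'.
have [Fk _ kg hk] := kP ga Sg.2.
exists t, (k ga).1, (Order.max ep e0); split => //; first by rewrite gt_max ept e0t.
  by move=> be /kg; exact: lt_trans.
move=> al be; rewrite gt_max => /andP[ea e0a] at' kbe; apply: lt_le_trans (hc al ea at') _.
have bk : be < ka by have [_ hF _ _] := fF; have [h _] := hF _ Fk; exact: h.
apply: (sup_finite_ge lt (fV al be) (Vt al be bk)); exists ga => //.
by apply: hk => //; [rewrite Eg|exact: lt_trans tg].
Qed.

End PosHit.

Lemma ex_engine : exists L rho e E, [/\ cseq e, regular L /\ regular rho,
   cf la < L, L < rho & [/\ rho < la, club ka E & pos la ka rho e E setT]].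
Proof.
have [_ _ ll cl] := la_props H.
have [L [mL Ll rL]] := next_regular' H cl; have [rho [Lr rl rr]] := next_regular' H Ll.
have [e [eP _]] := ex_cseq club_below.
have [E cE pE] := guess H eP rr (lt_trans mL Lr) rl rL mL Lr.
by exists L, rho, e, E.
Qed.

Lemma hitting_U th c : olim th -> coloring ka th c -> hitting th c -> U_principle ka ka th (cf la).
Proof.
move=> lt cc hc; have [L [rho [e [E [eP [rL rr] mL Lr [rl cE pE]]]]]] := ex_engine.
exact: (hitting_pos_U eP rr (lt_trans mL Lr) rl lt pE cc hc).
Qed.

Lemma below_one x : below (osucc \bot) x -> x = \bot.
Proof.
move=> /= xo; apply/eqP; rewrite -lex0 leNgt; apply/negP => x0.
by have := osucc_le x0; rewrite leNgt xo.
Qed.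

Lemma card_set2 x y : x <> y -> [set x; y] #= `I_2.
Proof.
move=> xy; apply: Cantor_Bernstein.
  apply/(card_leE 0%N); exists (fun z => if z == x then 0%N else 1%N); split => [z _|z w].
    by case: ifP.
  by move=> [->|->] [->|->] //=; rewrite eqxx; case: eqP => // E; case: xy.
apply/(card_leE \bot); exists (fun n => if n is 0%N then x else y); split.
  by case=> [|n] _; [left|right].
by move=> [|[|m]] [|[|n]] //= _ _ E; case: xy.
Qed.

Lemma unbounded_card ka' X : regular ka' -> X `<=` below ka' ->
  (forall x, x < ka' -> exists2 y, X y & x <= y) -> X #= below ka'.
Proof.
move=> [lk ck] Xk Xu; apply: Cantor_Bernstein; first exact: subset_card_le.
by rewrite -{1}ck; apply: cof_card.
Qed.

Lemma below_two : \bot < osucc (\bot : O) /\ below (osucc (osucc \bot)) = [set \bot; osucc (\bot : O)].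
Proof.
have lk := ka_lim H; have [o1 o2] := olim_succ lk lk.1.
have [t1 t2] := olim_succ lk o2; split => //.
apply/seteqP; split => x /=; last first.
  by case=> ->; [exact: lt_trans o1 t1|].
move=> xt; case: (ltgtP x (osucc \bot)) => [/below_one->|xo|->]; [by left| |by right].
by have := osucc_le xo; rewrite leNgt xt.
Qed.

Lemma two_card : below (ord_of_nat 2 : O) #= `I_2.
Proof.
have [o1 E2] := below_two.
apply: (@least_mem [set a | below a #= `I_2] (osucc (osucc \bot))).
by rewrite /= E2; apply: card_set2 => E; move: o1; rewrite -E ltxx.
Qed.

Lemma one_lt_two : osucc (\bot : O) < ord_of_nat 2.
Proof.
rewrite ltNge; apply/negP => /below_le tle.
have : `I_2 #<= `I_1.
  rewrite -(card_le_eql two_card); apply: card_le_trans tle _.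
  apply/(card_leE 0%N); exists (fun=> 0%N); split => // x y /below_one-> /below_one->.
  by [].
by rewrite card_le_II.
Qed.

Lemma U_closed th c : olim th -> closed_coloring ka th c ->
  U_witness ka (ord_of_nat 2) th (ord_of_nat 2) c -> U_principle ka ka th (cf la).
Proof.
move=> lt clo [cc hc]; apply: (hitting_U lt cc) => S i C sS it cC.
apply: contrapT => nh.
(* When hitting fails, colours at most [i] occur cofinally below [t]; closedness transfers the bound
   to [t] itself. *)
have hom t ga : C t -> S ga -> ga < ka -> t < ga -> olim t -> c t ga <= i.
  move=> Ct Sg gk tg lim_t; have [_ ->//] : Dle c i ga t.
  apply: (clo ga i gk (ltW it)) => //; first by rewrite -lt0x; exact: lim_t.1.
  apply: cofin_sup; apply: contrapT => /not_cofin[ep ept hep]; apply: nh.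
  exists t, ga, ep; split => // al ea at'; rewrite ltNge; apply/negP => ci.
  have := hep al (conj (lt_trans at' tg) ci) at'; by rewrite leNgt ea.
have uk := ka_unc H; have lk := ka_lim H.
have cl : club ka [set g | [/\ \bot < g, g < ka & cofin setT g]].
  by apply: club_acc => // x /(olim_succ lk)[h1 h2]; exists (osucc x).
(* All pairs from [X] have colour at most [i], so its [ka] many singletons contradict the
   witness. *)
pose X := C `&` [set g | [/\ \bot < g, g < ka & cofin setT g]] `&` S.
have sX : stationary ka X := stationary_club uk sS (club_setI uk cC cl).
have Xk : X `<=` below ka by move=> x [[_ [_ xk _]] _].
have Xc : X #= below ka.
  apply: unbounded_card (ka_reg H) Xk _ => x xk.
  by have [y [Xy xy _]] := stationary_unbounded uk sX xk; exists y => //; exact: ltW.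
have [o1 _] := below_two.
have co : is_cardinal (osucc (\bot : O)).
  move=> y /below_one ->; have -> : below (\bot : O) = set0.
    by apply/seteqP; split => // z; rewrite /below /= ltx0.
  by rewrite card_eq_sym card_eq0 => /eqP E; have : below (osucc \bot) (\bot : O) := o1; rewrite E.
have b1 : below (osucc \bot) = [set (\bot : O)].
  by apply/seteqP; split => [x /below_one|x -> //].
pose F : set (set O) := [set [set x] | x in X].
have Fc : F #= below ka.
  apply: card_eq_trans Xc; apply: inj_card_eq => x y _ _ E.
  by have : [set y] x by rewrite -E.
have [||G [GF Gc hG]] := hc _ co one_lt_two F _ Fc _ i it.
- by move=> _ [x Xx <-]; split => [y ->|]; [exact: Xk|rewrite b1; exact: eq_card1].
- by move=> _ _ [x _ <-] [y _ <-] [z [/= -> ->]].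
have : `I_2 #<= G.
  by rewrite (card_le_eqr Gc) -(card_le_eql two_card); apply: card_lexx.
move=> /(card_leE set0)[f [fG fi]].
have G0 : G (f 0%N) by exact: fG.
have G1 : G (f 1%N) by exact: fG.
have f01 : f 0%N <> f 1%N by move=> E; have := fi 0%N 1%N isT isT E.
have hxy x y : X x -> X y -> G [set x] -> G [set y] -> x < y -> False.
  move=> Xx Xy Gx Gy xy.
  have neq : [set x] <> [set y].
    by move=> E; have /= E' : [set y] x by [rewrite -E]; move: xy; rewrite E' ltxx.
  have slt : set_lt [set x] [set y] by move=> u v -> ->.
  have := hG _ _ Gx Gy neq slt.
  have Lc : [set c al be | al in [set x] & be in [set y]] (c x y).
    exact: (ex_intro2 _ _ x erefl (ex_intro2 _ _ y erefl erefl)).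
  have [u /= -> [v /= -> <-]] := least_mem Lc.
  case: Xx => [[Cx [x0 xk lx]] Sx]; case: Xy => [[Cy [y0 yk ly]] Sy].
  by rewrite ltNge hom.
have [x Xx fx] := GF _ G0; have [y Xy fy] := GF _ G1.
rewrite -fx in G0 f01; rewrite -fy in G1 f01.
case: (ltgtP x y) => xy; [exact: hxy xy|exact: (hxy y x)|by apply: f01; rewrite xy].
Qed.

End Principles.

(** * The cases [cf theta = cf lambda] and [cf theta = omega] *)

Implicit Types (eta : O).

Section LocallySmall.
Variables (la ka : O).
Hypothesis (H : succ_singular la ka).

(** Color by the block of [la] into which an injection of [be] sends [al]. Below a point of
    cofinality above [f i] and [cf la], too few [al] have colour at most [i] to be cofinal. *)
Lemma U_cf_la : U_principle ka ka (cf la) (cf la).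
Proof.
have [cl il ll cll] := la_props H; have lk := ka_lim H.
have [f [fl fm fc]] := cf_cofinal ll.
have hp be : exists p : O -> O, be < ka -> (forall al, al < be -> p al < la) /\
    (forall al al', al < be -> al' < be -> p al = p al' -> al = al').
  case: (pselect (be < ka)) => [bk|]; last by exists id.
  by have /(card_leE \bot)[p [p1 p2]] := card_ka H bk; exists p.
have [p pP] := choice hp.
pose c al be := least [set j | p be al <= f j].
have cP al be : al < be -> be < ka -> c al be < cf la /\ p be al <= f (c al be).
  move=> ab bk; have [h1 _] := pP be bk; have [j jc pj] := fc _ (h1 al ab).
  have hj : [set j | p be al <= f j] j by exact: ltW.
  split; last exact: least_mem hj.
  by apply: le_lt_trans jc; apply: least_le.
exists c; apply: (hits_U_witness H) => [|al be ab bk|ch' F i chl fF ic E cE].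
- exact: cf_le.
- by have [] := cP al be ab bk.
have nl : Order.max (f i) (cf la) < la by rewrite gt_max fl.
have [ga [Ega _ gk]] := point_cf_gt H nl cE lk.1.
rewrite gt_max => /andP[fg cg].
have lg : olim ga := cf_gt_lim (cf_gt0 ll.1) cg.
have [B FB hB] := family_above H fF gk.
have [_ hF _ _] := fF; have [Bk /card_eqPle[Bc _]] := hF B FB.
have h be : exists ep, B be -> ep < ga /\ forall al, al < ga -> c al be <= i -> al < ep.
  case: (pselect (B be)) => [Bb|]; last by exists \bot.
  have bk := Bk be Bb; have gb := hB be Bb.
  pose D := [set al | al < ga /\ c al be <= i].
  have [s1 s2] := olim_succ (cf_lim lg) fg.
  have sD : small ga D.
    apply: (small_card_le lg s2); apply/(card_leE \bot); exists (p be); split => [al [ag ci]|al al' [ag _] [ag' _]].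
      have [_ h] := cP al be (lt_trans ag gb) bk; apply: le_lt_trans (le_trans h _) s1.
      exact: fm.
    by apply: (pP be bk).2; exact: lt_trans gb.
  have [ep epg hep] := @bounded_img _ _ D id lg sD (fun al h => h.1).
  by exists ep => _; split => // al ag ci; apply: hep.
have [k kP] := choice h.
have sB : small ga B := small_card_le lg (lt_trans chl cg) Bc.
have [ep epg hep] := bounded_img lg sB (fun be Bb => (kP be Bb).1).
exists ga, B, ep; split => // al be ea ag Bb; rewrite ltNge; apply/negP => ci.
have := (kP be Bb).2 al ag ci; by rewrite ltNge (ltW (lt_trans (hep be Bb) ea)).
Qed.

Lemma iter_succ_mono a m n : olim a -> (m <= n)%N -> iter m osucc (\bot : O) <= iter n osucc \bot.
Proof.
move=> la'; have sa k : iter k osucc (\bot : O) < a.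
  by elim: k => [|k ih]; [exact: la'.1|exact: (olim_succ la' ih).2].
elim: n => [|n ih]; first by rewrite leqn0 => /eqP->.
rewrite leq_eqVlt => /orP[/eqP->//|/ih h]; apply: (le_trans h).
by apply/ltW; have [] := olim_succ la' (sa n).
Qed.

Lemma omega_cofinal i : i < (omega : O) -> olim (omega : O) -> exists n, i <= iter n osucc (\bot : O).
Proof.
move=> io lo; apply: contrapT => ne.
have : ~ infinite_set (below i) := not_lt_least io; apply.
apply/infiniteP/(card_leE \bot); exists (fun n => iter n osucc \bot).
have sa n : iter n osucc (\bot : O) < i by rewrite ltNge; apply/negP => h; apply: ne; exists n.
have sS n : iter n osucc (\bot : O) < iter n.+1 osucc \bot by apply: osucc_gt (sa n).
have so n : iter n osucc (\bot : O) < omega by apply: lt_trans (sa n) io.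
split => [m _|m n _ _ E]; first exact: sa.
apply/eqP; rewrite eqn_leq; apply/andP; split; rewrite leqNgt; apply/negP.
  move=> nm; have := iter_succ_mono lo nm; rewrite E leNgt; by rewrite sS.
move=> mn; have := iter_succ_mono lo mn; rewrite -E leNgt; by rewrite sS.
Qed.

(** * The length of the walk *)

Section Rho2.
Variable e : O -> set O.
Hypothesis eP : cseq e.

(** The number of steps of the walk, known as the function rho_2. *)
Lemma ex_rho2 : exists r : O -> O -> nat, forall al be,
  r al be = if al < be then (r al (step e al be)).+1 else 0%N.
Proof.
have h al : exists r : O -> nat, forall be,
    r be = if al < be then (r (step e al be)).+1 else 0%N.
  have [x q q' t qq ->|r rP] := @wfrec_choice nat
     (fun be (q : O -> nat) (m : nat) => m = if al < be then (q (step e al be)).+1 else 0%N) 0%N.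
    by case: ifP => // ax; rewrite qq //; case: (stepP eP ax).
  by exists r => be; apply: rP; eexists.
by have [r rP] := choice h; exists r.
Qed.

Variable r : O -> O -> nat.
Hypothesis rE : forall al be, r al be = if al < be then (r al (step e al be)).+1 else 0%N.

Definition above_fam ch (b : O -> set O) := forall de, de < ka ->
  b de #<= below ch /\ forall be, b de be -> de < be /\ be < ka.

(** When [cf ga] exceeds the cofinalities of all [be] in [b de], their C-sets are too small to be
    cofinal in [ga]; pressing down fixes the bound. *)
Lemma rho2_gap ch (b : O -> set O) : ch < cf la -> above_fam ch b ->
  exists2 ep, ep < ka & forall eta, eta < ka -> exists de ga, [/\ eta < ga, ga <= de, de < ka &
     forall be x, b de be -> e be x -> ep < x -> ga <= x].
Proof.
move=> chl hb; have [cl il ll cll] := la_props H; have lk := ka_lim H; have uk := ka_unc H.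
pose good ga (p : O * O) := [/\ ga <= p.1, p.1 < ka, p.2 < ga &
  forall be x, b p.1 be -> e be x -> p.2 < x -> ga <= x].
have hg ga : exists p, (exists p, good ga p) -> good ga p.
  by case: (pselect (exists p, good ga p)) => [[p gp]|ne]; [exists p|exists (\bot, \bot)].
have [k kP] := choice hg.
pose S := [set ga | ga < ka /\ exists p, good ga p].
have sS : stationary ka S.
  move=> C cC.
  (* A candidate for each [nu] is chosen before [de], since the bound on cofinalities in [b de] is
     known only once [de] is fixed. *)
  have h nu : exists ga, nu < la -> [/\ C ga, ga < ka & nu < cf ga].
    case: (pselect (nu < la)) => [nl|]; last by exists \bot.
    by have [ga [? ? ? ?]] := point_cf_gt H nl cC lk.1; exists ga.
  have [g gP] := choice h.
  have [de dk hde] := bounded_img lk (small_ka H (la_ka H))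
     (fun nu nl => let: And3 _ h _ := gP nu nl in h).
  have [bc bk] := hb de dk.
  have sl : small la (b de) := small_card_le ll chl bc.
  have [nu1 n1l hn1] := bounded_img ll sl (fun be Bb => cf_lt_la H (bk be Bb).2).
  pose nu := Order.max nu1 (cf la).
  have nl : nu < la by rewrite gt_max n1l.
  have [Cg gk ng] := gP nu nl.
  have n1n : nu1 <= nu by rewrite le_max lexx.
  have cn : cf la <= nu by rewrite le_max lexx orbT.
  have lg : olim (g nu) by apply: (cf_gt_lim _ ng); apply: lt_le_trans cn; exact: cf_gt0 ll.1.
  exists (g nu); split => //; split => //.
  have h' be : exists ep, b de be -> ep < g nu /\ forall x, e be x -> x < g nu -> x < ep.
    case: (pselect (b de be)) => [Bb|]; last by exists \bot.
    have sD : small (g nu) (e be `&` below (g nu)).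
      have [_ _ _ ek] := eP be.
      apply: (small_card_le lg (lt_trans (lt_le_trans (hn1 be Bb) n1n) ng)).
      by apply: card_le_trans ek; apply: subset_card_le => x [].
    have [ep epg hep] := @bounded_img _ _ _ id lg sD (fun x h => h.2).
    by exists ep => _; split => // x ex xg; apply: hep.
  have [k' kP'] := choice h'.
  have sB : small (g nu) (b de) := small_card_le lg (lt_trans chl (le_lt_trans cn ng)) bc.
  have [ep epg hep] := bounded_img lg sB (fun be Bb => (kP' be Bb).1).
  exists (de, ep); split => //=; first by apply: ltW; exact: hde.
  move=> be x Bb ex epx; rewrite leNgt; apply/negP => xg.
  have := lt_trans ((kP' be Bb).2 x ex xg) (hep be Bb); by rewrite ltNge (ltW epx).
have [e0 e0k sS'] := @fodor ka S (fun ga => (k ga).2) uk (ka_reg H).2 sS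
  (fun ga h _ => let: And4 _ _ h _ := kP ga h.2 in h).
exists e0 => // eta /(stationary_unbounded uk sS')[ga [[[gk /kP[h1 h2 h3 h4]] /= E] eg _]].
by exists (k ga).1, ga; split => //; rewrite -E.
Qed.

(** Across a gap the first step from [be] does not depend on [al]. The first steps form a family of
    the same kind, and passing to it gains one step. *)
Lemma rho2_unbounded ch n (b : O -> set O) : ch < cf la -> above_fam ch b ->
  exists2 ep, ep < ka & forall eta, eta < ka -> exists de, [/\ eta <= de, de < ka &
     forall be al, b de be -> ep < al -> al <= eta -> (n < r al be)%N].
Proof.
move=> chl; have lk := ka_lim H; elim: n b => [|n ih] b hb.
  exists \bot; first exact: lk.1.
  move=> eta ek; exists eta; split => // be al Bb _ ae; rewrite rE.
  by have [_ /(_ be Bb)[eb _]] := hb eta ek; rewrite (le_lt_trans ae eb).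
have [ep1 ep1k h1] := rho2_gap chl hb.
have h1' de : exists p : O * O, de < ka -> [/\ ep1 < p.1 /\ de < p.1, p.1 <= p.2, p.2 < ka &
     forall be x, b p.2 be -> e be x -> ep1 < x -> p.1 <= x].
  case: (pselect (de < ka)) => [dk|]; last by exists (de, de).
  have mk : Order.max ep1 de < ka by rewrite gt_max ep1k dk.
  have [de' [ga []]] := h1 _ mk; rewrite gt_max => /andP[? ?] ? ? ?.
  by exists (ga, de').
have [p pP] := choice h1'.
pose b' de := [set step e (p de).1 be | be in b (p de).2].
have hb' : above_fam ch b'.
  move=> de dk; have [[ep ed] h2 h3 h4] := pP de dk; have [bc bk] := hb _ h3.
  split; first by apply: card_le_trans bc; exact: card_image_le.
  move=> _ [be Bb <-]; have [pb bk'] := bk be Bb.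
  have [_ g1 g2] := stepP eP (le_lt_trans h2 pb).
  by split; [exact: lt_le_trans g1|exact: lt_trans bk'].
have [ep2 ep2k h2] := ih b' hb'.
exists (Order.max ep1 ep2); first by rewrite gt_max ep1k ep2k.
move=> eta ek; have [de [ed dk hde]] := h2 eta ek; have [[ep dp] pp pk hp] := pP de dk.
exists (p de).2; split => //; first by apply: le_trans ed (le_trans (ltW dp) pp).
move=> be al Bb; rewrite gt_max => /andP[a1 a2] ae.
have [_ /(_ be Bb)[pb bk]] := hb _ pk.
have ag : al < (p de).1 by apply: le_lt_trans dp; exact: le_trans ed.
have gb := le_lt_trans pp pb.
rewrite rE (lt_trans ag gb) ltnS.
have -> : step e al be = step e (p de).1 be.
  have [ez az zb] := stepP eP (lt_trans ag gb); have [ew gw wb] := stepP eP gb.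
  apply/le_anti/andP; split; first by apply: step_le => //; apply: le_trans gw; exact: ltW.
  by apply: step_le => //; apply: hp Bb ez (lt_le_trans a1 az).
by apply: hde => //; exists be.
Qed.

End Rho2.

Lemma U_omega : olim (omega : O) -> U_principle ka ka omega (cf la).
Proof.
move=> lo; have [e [eP _]] := ex_cseq club_below; have [r rE] := ex_rho2 eP.
have so n : iter n osucc (\bot : O) < omega.
  by elim: n => [|n ih]; [exact: lo.1|exact: (olim_succ lo ih).2].
exists (fun al be => iter (r al be) osucc \bot).
apply: (hits_U_witness H) => [|al be ab bk|ch' F i chl fF ic E cE]; [exact: cf_le|exact: so|].
have h de : exists B, de < ka -> F B /\ forall be, B be -> de < be.
  case: (pselect (de < ka)) => [dk|]; last by exists set0.
  by have [B] := family_above H fF dk; exists B.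
have [b bP] := choice h.
have hb : above_fam ch' b.
  move=> de dk; have [FB gB] := bP de dk; have [_ hF _ _] := fF.
  have [Bk /card_eqPle[Bc _]] := hF _ FB; split => // be Bb; split; [exact: gB|exact: Bk].
have [n ni] := omega_cofinal ic lo.
have [ep epk hep] := rho2_unbounded eP rE n chl hb.
have [/= _ /(_ ep epk)[ga [Eg eg gk]] _] := iffLR (clubP _ _) cE.
have [de [gd dk hde]] := hep ga gk.
have [FB gB] := bP de dk.
exists ga, (b de), ep; split => //; first by move=> be /gB; exact: le_lt_trans.
move=> al be ea ag Bb; apply: le_lt_trans ni _.
apply: (@lt_le_trans _ _ (iter n.+1 osucc \bot)).
  by have [] := olim_succ lo (so n).
by apply: iter_succ_mono lo _; apply: hde => //; exact: ltW.
Qed.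

End LocallySmall.

(** * The case [2 ^ lambda = lambda^+] *)

(* The intervals [x, y) are chosen one after the other with [y] below all
   earlier right ends above [x]; thus the intervals containing a given [al] have
   decreasing right ends, and there are finitely many of them. *)
Lemma interval_coloring (U : Type) (u0 : U) (P : set U) (X : U -> set O) (ci : U -> O) la th :
  is_cardinal la -> olim la -> olim th -> P #<= below la -> (forall p, P p -> ci p < th) ->
  exists c : O -> O, (forall al, c al < th) /\ forall p, P p -> below la #<= X p ->
    exists x y, [/\ X p x, X p y, x < y & forall al, x <= al -> al < y -> ci p <= c al].
Proof.
move=> cla ll lt /(card_leE \bot)[j [jl ji]] cit.
pose R t (q : O -> O * O) (r : O * O) := forall p, P p -> j p = t -> below la #<= X p ->
  [/\ X p r.1, X p r.2, r.1 < r.2 & forall s, s < t -> r.1 < (q s).2 -> r.2 < (q s).2].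
have [t q q' r qq hr p Pp jp Xp|f fP] := @wfrec_choice (O * O) R (\bot, \bot).
  by have [? ? ? h] := hr p Pp jp Xp; split => // s st; rewrite -qq //; apply: h.
have fR p : P p -> below la #<= X p -> R (j p) f (f (j p)).
  move=> Pp Xp; apply: fP; apply: contrapT => ne.
  have ne' x y : X p x -> X p y -> x < y -> exists s, [/\ s < j p, x < (f s).2 & (f s).2 <= y].
    move=> Xx Xy xy; apply: contrapT => ns; apply: ne; exists (x, y) => p' Pp' /(ji _ _ Pp' Pp) -> _.
    split => // s st xs /=; rewrite ltNge; apply/negP => sy; apply: ns; by exists s.
  (* If no interval fits, an earlier right end separates any two points of [X p]. Sending [x] to a
     stage with the least right end above it, or to [j p] if there is none, injects [X p] into the
     successor of [j p]. *)
  pose M x := [set z | exists s, [/\ s < j p, x < (f s).2 & (f s).2 = z]].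
  have hk x : exists s, s <= j p /\ ((M x !=set0 -> s < j p /\ (f s).2 = least (M x)) /\
      (~ (M x !=set0) -> s = j p)).
    case: (pselect (M x !=set0)) => [[z Mz]|nM]; last by exists (j p).
    have [s [sj xs E]] := least_mem Mz; exists s; split; first exact: ltW.
    by split => // -[]; exists z.
  have [k kP] := choice hk.
  have [s1 s2] := olim_succ ll (jl p Pp).
  apply: (cardinal_lt cla s2); apply: card_le_trans Xp _.
  apply/(card_leE \bot); exists k; split => [x _|].
    by have [h _] := kP x; apply: le_lt_trans h s1.
  have lem x y : X p x -> X p y -> x < y -> k x <> k y.
    move=> Xx Xy xy E; have [s [sj xs sy]] := ne' x y Xx Xy xy.
    have Mx : M x (f s).2 by exists s.
    have [_ [/(_ (ex_intro _ _ Mx))[kx E1] _]] := kP x.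
    have [_ [h1 h2]] := kP y; case: (pselect (M y !=set0)) => [My|nM]; last first.
      by move: kx; rewrite E (h2 nM) ltxx.
    have [_ E2] := h1 My; have [z Mz] := My; have [s' [_ ys' E3]] := least_mem Mz.
    have := least_le Mx; rewrite -E1 E E2 -E3 leNgt; by rewrite (le_lt_trans sy ys').
  move=> x y Xx Xy E; case: (ltgtP x y) => // xy; [case: (lem x y Xx Xy xy E)|].
  by case: (lem y x Xy Xx xy (esym E)).
pose T al := [set t | exists p, [/\ P p, j p = t, below la #<= X p & (f t).1 <= al < (f t).2]].
have Tdec al s t : T al s -> T al t -> s < t -> (f t).2 < (f s).2.
  move=> [p [Pp jp Xp /andP[p1 p2]]] [p' [Pp' jp' Xp' /andP[q1 q2]]] st.
  have [_ _ _] := fR p' Pp' Xp' p' Pp' erefl Xp'; rewrite jp' => /(_ s st); apply; exact: le_lt_trans q1 p2.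
have Tfin al : finite_set (T al).
  have inj : {in T al &, injective (fun t => (f t).2)}.
    move=> s t /set_mem Ts /set_mem Tt E; case: (ltgtP s t) => // h.
      by have := Tdec al s t Ts Tt h; rewrite E ltxx.
    by have := Tdec al t s Tt Ts h; rewrite E ltxx.
  rewrite -(eq_finite_set (inj_card_eq inj)); apply: antitone_finite => s t Ts Tt.
  by rewrite le_eqVlt => /orP[/eqP->//|st]; apply/ltW/(Tdec al).
have hi t : exists i, i < th /\ forall p, P p -> j p = t -> ci p = i.
  case: (pselect (exists2 p, P p & j p = t)) => [[p Pp jp]|ne].
    by exists (ci p); split; [exact: cit|move=> p' Pp' jp'; congr ci; apply: ji => //; rewrite jp jp'].
  by exists \bot; split; [exact: lt.1|move=> p Pp jp; case: ne; exists p].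
have [ii iiP] := choice hi.
pose V al := [set ii t | t in T al].
have Vfin al : finite_set (V al) by apply: finite_image.
have Vlt al x : V al x -> x < th by move=> [t _ <-]; exact: (iiP t).1.
exists (fun al => ord_sup (V al)); split; first by move=> al; exact: sup_finite_lt lt (Vfin al) (@Vlt al).
move=> p Pp Xp; have [X1 X2 lt12 _] := fR p Pp Xp p Pp erefl Xp.
exists (f (j p)).1, (f (j p)).2; split => // al a1 a2.
rewrite ((iiP (j p)).2 p Pp erefl).
apply: (sup_finite_ge lt (Vfin al) (@Vlt al)); exists (j p) => //.
by exists p; split => //; rewrite a1.
Qed.

Lemma U_gch la ka th : succ_singular la ka -> olim th -> th <= la ->
  ([set X : set O | X `<=` below la] #= below ka) -> U_principle ka ka th (cf la).
Proof.
move=> H lt tl /card_eqPle[/(card_leE \bot)[enc [encl enci]] _].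
have [cl il ll cll] := la_props H; have lk := ka_lim H.
have hpi eta : exists p : O -> O, eta < ka -> (forall x, x < eta -> p x < la) /\
    (forall x y, x < eta -> y < eta -> p x = p y -> x = y).
  case: (pselect (eta < ka)) => [ek|]; last by exists id.
  by have /(card_leE \bot)[p [p1 p2]] := card_ka H ek; exists p.
have [pi piP] := choice hpi.
(* A triple holds a bound [eta], the code of a subset of [la] and a colour; [pi eta] turns the coded
   set into a subset of [eta]. *)
pose X (p : O * O * O) : set O := [set x | x < p.1.1 /\
   exists Z : set O, [/\ Z `<=` below la, enc Z = p.1.2 & Z (pi p.1.1 x)]].
pose P be : set (O * O * O) := (below be `*` below be) `*` below th.
have cP be : be < ka -> P be #<= below la.
  move=> bk; have bl := card_ka H bk; have h := hessenberg il.
  apply: card_le_trans h; apply: (card_leX \bot \bot); last exact: below_le.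
  exact: card_le_trans (card_leX \bot \bot bl bl) (hessenberg il).
have hc be : exists c : O -> O, be < ka -> (forall al, c al < th) /\
    forall p, P be p -> below la #<= X p -> exists x y, [/\ X p x, X p y, x < y &
       forall al, x <= al -> al < y -> p.2 <= c al].
  case: (pselect (be < ka)) => [bk|]; last by exists id.
  have pt p : P be p -> p.2 < th by case.
  by have [c hc] := interval_coloring (\bot, \bot, \bot) X cl ll lt (cP be bk) pt; exists c.
have [c ccP] := choice hc.
apply: (@hitting_U _ _ H th (fun al be => c be al) lt) => [al be ab bk|]; first by have [h _] := ccP be bk.
move=> S i C sS it cC.
have uk := ka_unc H.
have Cc : C #= below ka.
  apply: unbounded_card (ka_reg H) _ _; first by case: cC.
  by move=> x xk; have /clubP[_ /(_ x xk)[y [Cy xy _]] _] := cC; exists y => //; exact: ltW.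
have : below la #<= C by rewrite (card_le_eqr Cc); apply/below_le/ltW/(la_ka H).
move=> /(card_leE \bot)[f [fC fi]].
have Ck : C `<=` below ka by case: cC.
have [eta ek fe] := bounded_img lk (small_ka H (la_ka H)) (fun x xl => Ck _ (fC x xl)).
pose Y := [set f x | x in below la].
have YC : Y `<=` C by move=> _ [x xl <-]; exact: fC.
have Ye : Y `<=` below eta by move=> _ [x xl <-]; exact: fe.
have [pl pinj] := piP eta ek.
pose Z := [set pi eta x | x in Y].
have Zl : Z `<=` below la by move=> _ [x Yx <-]; apply: pl; exact: Ye.
pose p : O * O * O := (eta, enc Z, osucc i).
have XE : X p = Y.
  apply/seteqP; split => [x /= [xe [Z' [Z'l E Z'x]]]|x Yx].
    have ZZ : Z' = Z by apply: enci.
    by move: Z'x; rewrite ZZ => -[y Yy /pinj yx]; rewrite -yx //; exact: Ye.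
  by split; [exact: Ye|exists Z; split => //; exists x].
have ezk : enc Z < ka by exact: encl.
have mk : Order.max eta (enc Z) < ka by rewrite gt_max ek.
(* Above [eta] and the code of [Z], the requirement for [Y] is among those treated at [ga]; its
   colour [osucc i] makes the final inequality strict. *)
have [ga [Sga]] := stationary_unbounded uk sS mk; rewrite gt_max => /andP[eg zg] gk.
have [i1 i2] := olim_succ lt it.
have Pp : P ga p by split => //; split.
have lY : below la #<= X p.
  by rewrite XE; apply/(card_leE \bot); exists f; split => // x xl; exists x.
have [x [y [Xx Xy xy hxy]]] := (ccP ga gk).2 p Pp lY.
rewrite XE in Xx Xy.
exists y, ga, x; split => //; [exact: YC|exact: lt_trans (Ye _ Xy) eg|].
by move=> al xa ay; apply: lt_le_trans i1 (hxy al (ltW xa) ay).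
Qed.

(** * The case [2 ^ cf lambda < lambda] *)

Implicit Types (j rho u : O) (V : set O).

(** The ideal complementary to [pos]; one club constrains both [de] and [ga]. *)
Definition null la ka rho (e : O -> set O) E X := exists2 C, club ka C &
  forall de, C de -> de < ka -> cf de = rho -> exists p : O * O, [/\ p.1 < la, p.2 < de &
    forall nu ga, p.1 <= nu < la -> reach e E nu de ga -> C ga -> X ga -> p.2 < ga < de ->
      nu < cf ga -> False].

Lemma not_pos la ka rho (e : O -> set O) E X : ~ pos la ka rho e E X -> null la ka rho e E X.
Proof.
move=> /existsNP[C /not_implyP[cC nC]]; exists C => // de Cde dk cd.
apply: contrapT => np; apply: nC; exists de; split => // nu0 eta n0 ed.
apply: contrapT => np2; apply: np; exists (nu0, eta); split => //= nu ga n1 rg Cg Xg gd ng.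
by apply: np2; exists nu, ga.
Qed.

Lemma ex_chain si (v : O -> O) : regular si -> (forall x, x < si -> v x < si) ->
  exists J : O -> O, forall a, a < si -> J a < si /\ forall x, x < a -> v (J x) < J a.
Proof.
move=> [ls cs] hv.
pose R a (q : O -> O) j := j < si /\ forall x, x < a -> v (q x) < j.
have [a q q' j qq [jm hj]|J JP] := @wfrec_choice O R \bot.
  by split => // x xa; rewrite -qq //; exact: hj.
exists J; elim/oind => a ih am; apply: JP.
have ac : a < cf si by rewrite cs.
have [y ym hy] := bounded_below ls ac (fun x xa => hv _ (ih x xa (lt_trans xa am)).1).
by exists y.
Qed.

(** Along a sparse sequence [J] the values of [v] are distinct. A pairing function divides the
    indices into [th] classes of size [mu], and the class of a value is its label. *)
Lemma ex_spread mu th (v : O -> O) : regular mu -> is_cardinal mu -> th < mu -> olim th ->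
  (forall j, j < mu -> j < v j /\ v j < mu) ->
  exists h : O -> O, (forall u, h u < th) /\
    forall i j0, i < th -> j0 < mu -> exists j, [/\ j0 <= j, j < mu & i < h (v j)].
Proof.
move=> [lm cm] cam tm lt hv.
have im := lim_infinite lm.
have [J hJ] := ex_chain (conj lm cm) (fun j jm => (hv j jm).2).
have Jm a b : a < b -> b < mu -> v (J a) < J b by move=> ab bm; have [_] := hJ b bm; apply.
have Jge a : a < mu -> a <= J a.
  elim/oind: a => a ih am; rewrite leNgt; apply/negP => Ja.
  have := ih _ Ja (lt_trans Ja am); rewrite leNgt; apply/negP; rewrite negbK.
  by apply: lt_trans (Jm _ _ Ja am); apply: (hv _ _).1; case: (hJ _ (lt_trans Ja am)).
have Jinj a b : a < mu -> b < mu -> v (J a) = v (J b) -> a = b.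
  have hl x y : x < y -> y < mu -> v (J x) < v (J y).
    by move=> ab bm; apply: lt_trans (Jm x y ab bm) _; apply: (hv _ _).1; case: (hJ _ bm).
  move=> am bm E; case: (ltgtP a b) => // h; exfalso.
    by have := hl a b h bm; rewrite E ltxx.
  by have := hl b a h am; rewrite E ltxx.
have /(card_leE \bot)[p [pm pinj]] : below mu `*` below th #<= below mu.
  by apply: card_le_trans (hessenberg im); apply: (card_leX \bot \bot) => //; exact/below_le/ltW.
have hh u : exists i, i < th /\ forall x i', x < mu -> i' < th -> u = v (J (p (x, i'))) -> i = i'.
  case: (pselect (exists x i', [/\ x < mu, i' < th & u = v (J (p (x, i')))])) => [[x [i [xm it uE]]]|ne].
    exists i; split => // x' i' x'm i't; rewrite uE.
    have h1 : (below mu `*` below th) (x, i) by [].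
    have h2 : (below mu `*` below th) (x', i') by [].
    by move=> /(Jinj _ _ (pm _ h1) (pm _ h2))/(pinj _ _ h1 h2)[].
  by exists \bot; split => [|x i xm it uE]; [exact: lt.1|case: ne; exists x, i].
have [h hP] := choice hh; exists h; split => [u|i j0 it j0m]; first exact: (hP u).1.
have [i1 i2] := olim_succ lt it.
have [x [xm px]] : exists x, x < mu /\ j0 <= p (x, osucc i).
  apply: contrapT => ne; apply: (cardinal_lt cam j0m).
  apply/(card_leE \bot); exists (fun x => p (x, osucc i)); split => [x xm|x y xm ym].
    by rewrite /below /= ltNge; apply/negP => h0; apply: ne; exists x.
  have h1 : (below mu `*` below th) (x, osucc i) by [].
  have h2 : (below mu `*` below th) (y, osucc i) by [].
  by move=> /(pinj _ _ h1 h2)[].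
have pm' := pm (x, osucc i) (conj xm i2).
exists (J (p (x, osucc i))); split; [|by case: (hJ _ pm')|].
  exact: le_trans px (Jge _ pm').
by rewrite ((hP (v (J (p (x, osucc i))))).2 x (osucc i) xm i2 erefl).
Qed.

Lemma U_small_power la ka th : succ_singular la ka -> olim th -> th < cf la ->
  card_lt [set X : set O | X `<=` below (cf la)] (below la) -> U_principle ka ka th (cf la).
Proof.
move=> H lt tm [P2 _].
have [cl il ll cll] := la_props H; have lk := ka_lim H; have uk := ka_unc H.
have rm := cf_regular ll; have cm := cf_cardinal ll.
have [L [rho [e [E [eP [rL rr] mL Lr [rl cE pE]]]]]] := ex_engine H.
have mur := lt_trans mL Lr.
have [f [fl fm fc]] := cf_cofinal ll.
pose jj ga := least [set j | cf ga <= f j].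
have jjP ga : ga < ka -> jj ga < cf la /\ cf ga <= f (jj ga).
  move=> /(cf_lt_la H)/fc[j jm cj]; have hj : [set j | cf ga <= f j] j by exact: ltW.
  by split; [apply: le_lt_trans jm; exact: least_le|exact: least_mem hj].
pose XV V := [set ga | V (jj ga)].
have hC V : exists C, null la ka rho e E (XV V) -> club ka C /\
  forall de, C de -> de < ka -> cf de = rho -> exists p : O * O, [/\ p.1 < la, p.2 < de &
    forall nu ga, p.1 <= nu < la -> reach e E nu de ga -> C ga -> XV V ga -> p.2 < ga < de ->
      nu < cf ga -> False].
  case: (pselect (null la ka rho e E (XV V))) => [[C cC h]|]; last by exists setT.
  by exists C.
have [C CP] := choice hC.
(* There are at most [la] null sets of this form, so one club serves for all of them. *)
pose P := [set V | V `<=` below (cf la) /\ null la ka rho e E (XV V)].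
have sP : small ka P.
  apply: small_le (small_ka H (la_ka H)); apply: card_le_trans P2.
  by apply: subset_card_le => V [].
have cD := club_bigcap uk sP (fun V h => (CP V h.2).1).
set D := [set _ | _] in cD.
have [de [Dde dk cd hde]] := pE _ cD.
have ld : olim de by apply: (cf_gt_lim (cf_gt0 ll.1)); rewrite cd.
pose seen v nu0 := forall eta, eta < de -> exists nu ga, [/\ nu0 <= nu < la, reach e E nu de ga,
  D ga /\ jj ga = v, eta < ga < de & nu < cf ga].
(* Only [cf la < cf de] values of [jj] compete, so one is met arbitrarily near [de]. It exceeds [j]
   because [cf ga > nu >= f j]. *)
have hv j : exists v, j < cf la -> [/\ j < v, v < cf la & seen v (f j)].
  case: (pselect (j < cf la)) => [jm|]; last by exists \bot.
  have [v [vm sv]] : exists v, v < cf la /\ seen v (f j).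
    apply: contrapT => ne.
    have he v : exists eta, v < cf la -> eta < de /\ forall nu ga, f j <= nu < la ->
       reach e E nu de ga -> D ga -> jj ga = v -> eta < ga < de -> nu < cf ga -> False.
      case: (pselect (v < cf la)) => [vm|]; last by exists \bot.
      apply: contrapT => ne2; apply: ne; exists v; split => // eta ed.
      apply: contrapT => ne3; apply: ne2; exists eta => _; split => // nu ga *.
      by apply: ne3; exists nu, ga.
    have [k kP] := choice he.
    have md : cf la < cf de by rewrite cd.
    have [eta ed hk] := bounded_below ld md (fun v vm => (kP v vm).1).
    have [nu [ga [n1 rg [Dg _] /andP[eg gd] ng]]] := hde (f j) eta (fl j jm) ed.
    have [jg _] := jjP ga (lt_trans gd dk).
    apply: ((kP _ jg).2 nu ga n1 rg Dg erefl _ ng); by rewrite gd (lt_trans (hk _ jg) eg).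
  exists v => _; split => //.
  have [nu [ga [/andP[n1 _] _ [Dg <-] /andP[_ gd] ng]]] := sv _ ld.1.
  have [jm' cj] := jjP ga (lt_trans gd dk).
  rewrite ltNge; apply/negP => jv.
  have := le_trans cj (fm _ _ jv jm); by rewrite leNgt (le_lt_trans n1 ng).
have [v vP] := choice hv.
have [h [hth hsp]] := ex_spread rm cm tm lt (fun j jm => let: And3 h1 h2 _ := vP j jm in conj h1 h2).
apply: (pos_U (E := E) H eP rr mur rl (h := h \o jj) lt) => [x|i it]; first exact: hth.
(* If the points with value in [V] were null, the fixed [de] would have a threshold for them; but
   [V] contains values seen from [de] for arbitrarily large [nu]. *)
pose V := [set u | u < cf la /\ i < h u].
apply: contrapT => /not_pos nul.
have nul' : null la ka rho e E (XV V).
  have [C' cC' hC'] := nul; exists C' => // de' Cde' dk' cd'.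
  have [p [p1 p2 hp]] := hC' de' Cde' dk' cd'; exists p; split => // nu ga n1 rg Cg [_ Xg].
  exact: hp n1 rg Cg Xg.
have PV : P V by split => // u [].
have [_ hV] := CP V nul'.
have [p [p1 p2 hp]] := hV de (Dde.2 V PV) dk cd.
have [j0 j0m pj0] := fc _ p1.
have [j [j0j jm ij]] := hsp i j0 it j0m.
have [_ vm sv] := vP j jm.
have [nu [ga [/andP[n1 n2] rg [Dg jg] gd ng]]] := sv _ p2.
apply: (hp nu ga _ rg (Dg.2 V PV) _ gd ng).
  by rewrite n2 andbT; apply: le_trans n1; apply: le_trans (ltW pj0) _; exact: fm.
by rewrite /XV /= jg; split.
Qed.

(** * Failure of reflection *)

Implicit Types (s : O) (Y D T : set O).

Lemma not_stationary al S : ~ stationary al S -> exists2 C, club al C & forall x, C x -> ~ S x.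
Proof.
move=> /existsNP[C /not_implyP[cC ne]]; exists C => // x Cx Sx.
by apply: ne; exists x.
Qed.

Lemma stationary_sub al S S' : S `<=` S' -> stationary al S -> stationary al S'.
Proof. by move=> SS sS C /sS[x [Cx /SS Sx]]; exists x. Qed.

Lemma lim_of_cf th y : olim th -> th <= cf y -> olim y.
Proof.
move=> lt ty; have [h1 h2] := olim_succ lt lt.1.
exact: cf_gt_lim h1 (lt_le_trans h2 ty).
Qed.

(** An Ulam matrix argument with injections [p x] of [x] into [la]: for each [eta] some value of
    [p x eta] is taken stationarily often in [T]. One value [nu0] serves for [th] many [eta], and
    injectivity makes the pieces disjoint. *)
Lemma stationary_split la ka th T : succ_singular la ka -> olim th -> th < ka -> stationary ka T ->
  exists h : O -> O, (forall x, h x < th) /\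
    forall i, i < th -> stationary ka (T `&` [set x | i < h x]).
Proof.
move=> H lt tk sT; have uk := ka_unc H; have lk := ka_lim H.
have sl : small ka (below la) := small_ka H (la_ka H).
have hp x : exists p : O -> O, x < ka -> (forall y, y < x -> p y < la) /\
    forall y z, y < x -> z < x -> p y = p z -> y = z.
  case: (pselect (x < ka)) => [xk|]; last by exists id.
  by have [p ?] := (card_leE \bot _ _).1 (card_ka H xk); exists p.
have [p pP] := choice hp.
have hn eta : exists nu, eta < ka -> nu < la /\
    stationary ka ([set x | eta < x /\ x < ka] `&` T `&` [set x | p x eta = nu]).
  case: (pselect (eta < ka)) => [ek|]; last by exists \bot.
  have [|nu nl sN] := @stationary_bigcup ka _ O (below la) (fun nu => [set x | p x eta = nu]) uk
     (stationary_club uk sT (club_above lk ek)) sl.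
    by move=> x [[ex xk] _] _; exists (p x eta) => //; apply: (pP x xk).1.
  by exists nu.
have [n nP] := choice hn.
have sT' : stationary ka setT by move=> C /clubP[_ /(_ _ lk.1)[y [Cy _ _]] _]; exists y.
have [|nu0 nl sN] := @stationary_bigcup ka _ O (below la) (fun nu => [set x | n x = nu]) uk sT' sl.
  by move=> x _ xk; exists (n x) => //; exact: (nP x xk).1.
have : below th #<= [set x | x < ka /\ n x = nu0].
  apply: card_le_trans (below_le (ltW tk)) _; rewrite -{1}(cf_ka H).
  apply: cof_card => // [x []//|x xk].
  by have [y [[_ ny] xy yk]] := stationary_unbounded uk sN xk; exists y => //; exact: ltW.
move=> /(card_leE \bot)[j [jY jinj]].
have hh x : exists i, i < th /\ forall i', i' < th -> j i' < x -> x < ka -> p x (j i') = nu0 -> i = i'.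
  case: (pselect (exists i', [/\ i' < th, j i' < x, x < ka & p x (j i') = nu0])) => [[i [it ji xk pi]]|ne].
    exists i; split => // i' it' ji' _ pi'; apply: jinj => //.
    by apply: (pP x xk).2 => //; rewrite pi pi'.
  by exists \bot; split => [|i it ji xk pi]; [exact: lt.1|case: ne; exists i].
have [h hP] := choice hh; exists h; split => [x|i it]; first exact: (hP x).1.
have [i1 i2] := olim_succ lt it; have [jk nj] := jY _ i2.
apply: stationary_sub (nP _ jk).2 => x [[[jx xk] Tx] px]; split => //=.
by rewrite ((hP x).2 _ i2 jx xk) // px.
Qed.

Lemma U_nonreflecting la ka th T : succ_singular la ka -> regular th -> th < ka -> stationary ka T ->
  (forall y, y < ka -> th <= cf y -> ~ stationary y T) -> U_principle ka ka th (cf la).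
Proof.
move=> H [lt ct] tk sT nT; have uk := ka_unc H; have lk := ka_lim H.
have [h [hth hst]] := stationary_split H lt tk sT.
have hC y : exists C, olim y -> club y C /\ (y < ka -> th <= cf y -> forall x, C x -> ~ T x).
  case: (pselect (y < ka /\ th <= cf y)) => [[yk ty]|ne].
    by have [C cC hC] := not_stationary (nT y yk ty); exists C => ly; split.
  by exists (below y) => ly; split => [|yk ty]; [exact: club_below|case: ne].
have [C CP] := choice hC.
have [e [eP eC]] := ex_cseq (fun y ly => (CP y ly).1).
(* If [cf y >= th], then [e y] avoids [T] and only [y] itself matters. Otherwise [e y] is small
   enough for its labels to be bounded in the regular [th]. *)
pose G y := [set x | x = y \/ (cf y < th /\ e y x)].
have hG y : exists2 b, b < th & forall x, G y x -> h x <= b.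
  case: (pselect (cf y < th)) => [cy|ncy]; last by exists (h y) => // x [->|[]].
  have [_ _ _ ek] := eP y.
  have cy' : cf y < cf th by rewrite ct.
  have [b bt hb] := bounded_img lt (small_card_le lt cy' ek) (fun x _ => hth x).
  exists (Order.max b (h y)); first by rewrite gt_max bt hth.
  by move=> x [->|[_ /hb/ltW xb]]; rewrite le_max ?lexx ?xb ?orbT.
pose Hs y := ord_sup (h @` G y).
have Hs_lt y : Hs y < th.
  have [b bt hb] := hG y; apply: le_lt_trans bt; apply: ord_sup_le => _ [x Gx <-]; exact: hb.
have Hs_ge y x : G y x -> h x <= Hs y.
  have [b bt hb] := hG y; move=> Gx; apply: (@ord_sup_ge _ b); last by exists x.
  by move=> _ [z Gz <-]; exact: hb.
pose V al be := [set Hs y | y in [set y | tr e al be y]].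
have fV al be : finite_set (V al be) by apply: finite_image; exact: tr_finite.
have Vt al be x : V al be x -> x < th by move=> [y _ <-].
apply: (hitting_U H (c := fun al be => ord_sup (V al be)) lt) => [al be _ _|S i E sS it cE].
  exact: sup_finite_lt lt (fV al be) (@Vt al be).
have cl : club ka [set g | [/\ \bot < g, g < ka & cofin setT g]].
  by apply: club_acc => // x /(olim_succ lk)[h1 h2]; exists (osucc x).
have [t [[Et [t0 tk' ctt]] [Tt it']]] := hst i it _ (club_setI uk cE cl).
have [ga [Sg tg gk]] := stationary_unbounded uk sS tk'.
have [D [ep [ept hD Dg hD']]] := walk eP (conj t0 ctt) tg.
exists t, ga, ep; split => // al ea at'; apply: lt_le_trans it' _.
have GD : G D t.
  case: hD' => [->|[tD eD _]]; first by left.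
  right; split => //; rewrite ltNge; apply/negP => tcD.
  have lD := lim_of_cf lt tcD.
  exact: (CP D lD).2 (le_lt_trans Dg gk) tcD t (eC D lD t eD) Tt.
apply: le_trans (Hs_ge _ _ GD) _; apply: (sup_finite_ge lt (fV al ga) (@Vt al ga)).
by exists D => //; exact: hD.
Qed.

(** Close off the successors of a cofinal [cf y]-sequence: a limit ordinal in the result is a limit
    of a proper initial segment of the sequence. *)
Lemma small_cf_club y : olim y -> exists2 D, club y D & forall g, D g -> olim g -> cf g < cf y.
Proof.
move=> ly; have [f [fy fm fc]] := cf_cofinal ly.
pose X := [set osucc (f x) | x in below (cf y)].
exists (X `|` [set g | [/\ \bot < g, g < y & cofin X g]]).
  apply/clubP; split.
  - by move=> _ [[x xc <-]|[]//]; exact: (olim_succ ly (fy _ xc)).2.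
  - move=> x /fc[w wc xf]; have [h1 h2] := olim_succ ly (fy _ wc).
    by exists (osucc (f w)); split => //; [left; exists w|exact: lt_trans h1].
  - move=> g g0 gy cg; right; split => // x xg; have [z [Yz xz zg]] := cg x xg.
    case: Yz => [Xz|[z0 zy cz]]; first by exists z.
    by have [w [Xw xw wz]] := cz x xz; exists w; split => //; exact: lt_trans zg.
move=> g [[x xc <-]|[g0 gy cg]] lg.
  have [h1 _] := olim_succ ly (fy _ xc).
  by have [_] := olim_succ lg h1; rewrite ltxx.
have [w wc gw] := fc g gy.
have hw : [set x | x < cf y /\ g <= f x] w by split => //; exact: ltW.
have [v [[vc gv] vl]] := ex_least hw.
apply: le_lt_trans (vc); apply: (cf_le_map (f := f)); split => [x xv|z zg].
  by rewrite ltNge; apply/negP => gx; have := vl x (conj (lt_trans xv vc) gx); rewrite leNgt xv.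
have [_ [[x xc <-] zx xg]] := cg z zg; exists x.
  rewrite ltNge; apply/negP => vx; have [fs _] := olim_succ ly (fy _ xc).
  by have := lt_trans (le_lt_trans (le_trans gv (fm _ _ vx xc)) fs) xg; rewrite ltxx.
by rewrite leNgt; apply/negP => /osucc_le fz; have := lt_le_trans zx fz; rewrite ltxx.
Qed.

(** At a limit of the club lying in [T], the club restricts to a club, which meets [S]. *)
Lemma stationary_reflects_down al S T : uncountable_cf al ->
  (forall y, T y -> uncountable_cf y /\ stationary y S) -> stationary al T -> stationary al S.
Proof.
move=> ual h sT C cC; have /clubP[Cs Cu Cc] := cC.
have [x [[x0 xa cx] Tx]] := sT _ (club_acc ual Cu); have [ux sx] := h x Tx.
have [|y [[Cy _] Sy]] := sx (C `&` below x); last by exists y.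
apply/clubP; split => [y []//|y yx|g g0 gx cg].
  by have [z [Cz yz zx]] := cx y yx; exists z.
split => //; apply: Cc => //; first exact: lt_trans xa.
by apply: cofin_sub cg => z [].
Qed.

(** * Reflecting stationary sets to higher cofinalities *)

Section Lifting.
Variables (la ka th : O).
Hypothesis (H : succ_singular la ka) (lt : olim th) (uth : forall y, th <= cf y -> uncountable_cf y).
Hypothesis R : forall T, stationary ka T ->
  stationary ka [set y | [/\ y < ka, th <= cf y & stationary y T]].

Lemma ex_lift T : stationary ka T -> exists s X,
  [/\ stationary ka X, th <= s, s < la, regular s &
      forall y, X y -> [/\ y < ka, cf y = s & stationary y T]].
Proof.
move=> /R sT; have uk := ka_unc H.
have [|s sl sX] := @stationary_bigcup ka _ O (below la) (fun s => [set y | cf y = s]) uk sT (small_ka H (la_ka H)).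
  by move=> y _ yk; exists (cf y) => //; exact: (cf_lt_la H).
have [y [[[yk ty _] cy] _ _]] := stationary_unbounded uk sX (ka_lim H).1.
have ts : th <= s by rewrite -cy.
exists s; eexists; split; [exact: sX|by []|by []| |by move=> z [[zk _ sz] cz]].
rewrite -cy; apply: cf_regular; exact: lim_of_cf lt ty.
Qed.

Lemma lift_cf_lt s y T : regular s -> (forall z, T z -> cf z = s) -> th <= s -> olim y ->
  stationary y T -> s < cf y.
Proof.
move=> [ls _] hT ts ly sT; have [D cD hD] := small_cf_club ly.
have [g [Dg Tg]] := sT D cD; rewrite -(hT g Tg); apply: hD => //.
by apply: (lim_of_cf lt); rewrite hT.
Qed.

(** Three successive lifts have strictly increasing cofinalities, so one of these differs from both
    [m] and [r]. *)
Lemma ex_lift_avoid T m r : stationary ka T -> exists s X,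
  [/\ stationary ka X, th <= s /\ s < la, regular s, s <> m /\ s <> r &
      (forall y, X y -> y < ka /\ cf y = s) /\
      forall al, uncountable_cf al -> stationary al X -> stationary al T].
Proof.
move=> sT.
have [s1 [X1 [sX1 t1 l1 r1 h1]]] := ex_lift sT.
have [s2 [X2 [sX2 t2 l2 r2 h2]]] := ex_lift sX1.
have [s3 [X3 [sX3 t3 l3 r3 h3]]] := ex_lift sX2.
have d1 al : uncountable_cf al -> stationary al X1 -> stationary al T.
  move=> ual; apply: stationary_reflects_down => // y /h1[_ cy sy]; split => //.
  by apply: uth; rewrite cy.
have d2 al : uncountable_cf al -> stationary al X2 -> stationary al T.
  move=> ual sal; apply: d1 => //; apply: stationary_reflects_down sal => // y /h2[_ cy sy].
  by split => //; apply: uth; rewrite cy.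
have d3 al : uncountable_cf al -> stationary al X3 -> stationary al T.
  move=> ual sal; apply: d2 => //; apply: stationary_reflects_down sal => // y /h3[_ cy sy].
  by split => //; apply: uth; rewrite cy.
have uk := ka_unc H; have k0 := (ka_lim H).1.
have s12 : s1 < s2.
  have [y [/h2[_ cy sy] _ _]] := stationary_unbounded uk sX2 k0; rewrite -cy.
  apply: (lift_cf_lt r1 _ t1 _ sy); first by move=> z /h1[].
  by apply: (lim_of_cf lt); rewrite cy.
have s23 : s2 < s3.
  have [y [/h3[_ cy sy] _ _]] := stationary_unbounded uk sX3 k0; rewrite -cy.
  apply: (lift_cf_lt r2 _ t2 _ sy); first by move=> z /h2[].
  by apply: (lim_of_cf lt); rewrite cy.
have s13 := lt_trans s12 s23.
have n12 : s1 <> s2 by move=> E; move: s12; rewrite E ltxx.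
have n23 : s2 <> s3 by move=> E; move: s23; rewrite E ltxx.
have n13 : s1 <> s3 by move=> E; move: s13; rewrite E ltxx.
have [c1|[c2|c3]] : (s1 <> m /\ s1 <> r) \/ (s2 <> m /\ s2 <> r) \/ (s3 <> m /\ s3 <> r).
  case: (pselect (s1 <> m /\ s1 <> r)) => c1; first by left.
  case: (pselect (s2 <> m /\ s2 <> r)) => c2; first by right; left.
  right; right; split => E.
    apply: c1; split => [E1|E1]; first by apply: n13; rewrite E1.
    apply: c2; split => [E2|E2]; first by apply: n23; rewrite E2.
    by apply: n12; rewrite E1.
  apply: c1; split => [E1|E1]; last by apply: n13; rewrite E1.
  apply: c2; split => [E2|E2]; last by apply: n23; rewrite E2.
  by apply: n12; rewrite E1.
- exists s1, X1; split => //; split => // y /h1[? ? _]; by split.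
- exists s2, X2; split => //; split => // y /h2[? ? _]; by split.
- exists s3, X3; split => //; split => // y /h3[? ? _]; by split.
Qed.

End Lifting.

(** * Closure properties of the ideal of unguessed sets *)

Section Null.
Variables (la ka rho : O) (e : O -> set O) (E : set O).
Hypotheses (H : succ_singular la ka) (mur : cf la < rho).
Local Notation null := (null la ka rho e E).
Local Notation pos := (pos la ka rho e E).

Lemma pos_not_null X : pos X -> ~ null X.
Proof.
move=> pX [C cC hC]; have [de [Cde dk cd hde]] := pX C cC.
have [p [p1 p2 hp]] := hC de Cde dk cd.
have [nu [ga [n1 rg [Cg Xg] gd ng]]] := hde _ _ p1 p2.
exact: hp n1 rg Cg Xg gd ng.
Qed.

Lemma null_sub X Y : X `<=` Y -> null Y -> null X.
Proof.
move=> XY [C cC hC]; exists C => // de Cde dk cd.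
have [p [p1 p2 hp]] := hC de Cde dk cd; exists p; split => // nu ga n1 rg Cg /XY; exact: hp.
Qed.

Lemma pos_sub X Y : X `<=` Y -> pos X -> pos Y.
Proof. by move=> XY pX; apply: contrapT => /not_pos/(null_sub XY); exact: pos_not_null. Qed.

Let null_common (U : Type) (P : set U) (X : U -> set O) : small ka P ->
  (forall p, P p -> null (X p)) -> exists2 D, club ka D & forall de, D de -> de < ka -> cf de = rho ->
   exists q : U -> O * O, forall p, P p -> [/\ (q p).1 < la, (q p).2 < de &
     forall nu ga, (q p).1 <= nu < la -> reach e E nu de ga -> D ga -> X p ga -> (q p).2 < ga < de ->
       nu < cf ga -> False].
Proof.
move=> sP nX.
have hC p : exists C, P p -> club ka C /\
  forall de, C de -> de < ka -> cf de = rho -> exists q : O * O, [/\ q.1 < la, q.2 < de &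
    forall nu ga, q.1 <= nu < la -> reach e E nu de ga -> C ga -> X p ga -> q.2 < ga < de ->
      nu < cf ga -> False].
  by case: (pselect (P p)) => [/nX[C cC h]|]; [exists C|exists setT].
have [C CP] := choice hC.
exists [set x | x < ka /\ forall p, P p -> C p x].
  by apply: (club_bigcap (ka_unc H) sP) => p /CP[].
move=> de [_ Dde] dk cd.
have hq p : exists q : O * O, P p -> [/\ q.1 < la, q.2 < de &
     forall nu ga, q.1 <= nu < la -> reach e E nu de ga -> C p ga -> X p ga -> q.2 < ga < de ->
       nu < cf ga -> False].
  case: (pselect (P p)) => [Pp|]; last by exists (\bot, \bot).
  by have [q hq] := (CP p Pp).2 de (Dde p Pp) dk cd; exists q.
have [q qP] := choice hq; exists q => p Pp; have [q1 q2 hp] := qP p Pp.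
by split => // nu ga n1 rg [_ Dg]; apply: hp => //; exact: Dg.
Qed.

(** Fewer than [cf la] thresholds are bounded both in [la] and in [de], since
    [cf la < rho = cf de]. *)
Lemma null_bigcup (U : Type) (P : set U) (X : U -> set O) : P #<= below (cf la) ->
  ~ (below (cf la) #<= P) -> (forall p, P p -> null (X p)) ->
  null [set ga | exists2 p, P p & X p ga].
Proof.
move=> P1 P2 nX; have [_ _ ll cl] := la_props H.
have sP : small ka P.
  by apply: (small_card_le (ka_lim H)) P1; rewrite (cf_ka H); exact: lt_trans cl (la_ka H).
have [D cD hD] := null_common sP nX; exists D => // de Dde dk cd.
have [q qP] := hD de Dde dk cd.
have ld : olim de by apply: (cf_gt_lim (cf_gt0 ll.1)); rewrite cd.
have [nu0 n0 h0] := @bounded_img _ _ P (fun p => (q p).1) ll P2 (fun p Pp => let: And3 h _ _ := qP p Pp in h).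
have sd : small de P by apply: (small_card_le ld) P1; rewrite cd.
have [eta ed he] := @bounded_img _ _ P (fun p => (q p).2) ld sd (fun p Pp => let: And3 _ h _ := qP p Pp in h).
exists (nu0, eta); split => //= nu ga /andP[n1 n2] rg Dg [p Pp Xg] /andP[eg gd] ng.
have [_ _ hp] := qP p Pp; apply: (hp nu ga) => //.
  by rewrite n2 (le_trans (ltW (h0 p Pp)) n1).
by rewrite gd (lt_trans (he p Pp) eg).
Qed.

(** Two uses of [pigeon] bound the thresholds in [la] and in [de] on an unbounded set of indices,
    which is enough for an increasing union. *)
Lemma null_chain si (X : O -> set O) : regular si -> si < la -> si <> cf la -> si <> rho ->
  (forall x, x < si -> null (X x)) -> (forall x y, x <= y -> y < si -> X x `<=` X y) ->
  null [set ga | exists2 x, x < si & X x ga].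
Proof.
move=> rs sl sm sr nX Xm; have [_ _ ll cl] := la_props H.
have [D cD hD] := null_common (small_ka H (lt_trans sl (la_ka H))) nX; exists D => // de Dde dk cd.
have [q qP] := hD de Dde dk cd.
have ld : olim de by apply: (cf_gt_lim (cf_gt0 ll.1)); rewrite cd.
have Z0 x : x < si -> exists y, [/\ setT y, x <= y & y < si] by exists x.
have [nu0 n0 h0] := @pigeon si la (fun x => (q x).1) setT rs ll (nesym sm) Z0
  (fun x xs => let: And3 h _ _ := qP x xs in h).
have Z1 x : x < si -> exists y, [/\ (q y).1 <= nu0, x <= y & y < si].
  by move=> /h0[y [_ xy ys qy]]; exists y.
have cdne : cf de <> si by rewrite cd => /esym.
have [eta ed he] := @pigeon si de (fun x => (q x).2) [set y | (q y).1 <= nu0] rs ld cdne Z1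
  (fun x xs => let: And3 _ h _ := qP x xs in h).
exists (nu0, eta); split => //= nu ga /andP[n1 n2] rg Dg [x xs Xg] /andP[eg gd] ng.
have [y [qy xy ys qe]] := he x xs.
have [_ _ hp] := qP y ys; apply: (hp nu ga) => //.
- by rewrite n2 (le_trans qy n1).
- exact: Xm Xg.
- by rewrite gd (le_lt_trans qe eg).
Qed.

(** By [null_chain] each guessed tail of [f] contains a guessed bounded interval. A sequence of
    disjoint such intervals supplies the labels. *)
Lemma pos_split si th (f : O -> O) : regular si -> si < la -> si <> cf la -> si <> rho ->
  olim th -> th <= si -> (forall ga, f ga < si) -> (forall x, x < si -> pos [set ga | x <= f ga]) ->
  exists h : O -> O, (forall ga, h ga < th) /\ forall i, i < th -> pos [set ga | i < h ga].
Proof.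
move=> rs sl sm sr lt ts fs fp.
have hv x : exists y, x < si -> [/\ x < y, y < si & pos [set ga | x <= f ga < y]].
  case: (pselect (x < si)) => [xs|]; last by exists \bot.
  apply: contrapT => ne; apply: (pos_not_null (fp x xs)).
  have nX y : y < si -> null [set ga | x <= f ga < y].
    move=> ys; case: (ltP x y) => xy.
      by apply: not_pos => py; apply: ne; exists y => _.
    have [x1 x2] := olim_succ rs.1 xs.
    apply: (@null_sub _ [set ga | x <= f ga < osucc x]).
      by move=> ga /= /andP[-> fy]; apply: lt_trans x1; exact: lt_le_trans xy.
    by apply: not_pos => py; apply: ne; exists (osucc x).
  apply: null_sub (null_chain rs sl sm sr nX _) => [ga /= xf|y z yz zs ga /= /andP[-> fy]].
    by have [f1 f2] := olim_succ rs.1 (fs ga); exists (osucc (f ga)) => //; rewrite xf.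
  exact: lt_le_trans fy yz.
have [v vP] := choice hv.
have [J JP] := ex_chain rs (fun x xs => let: And3 _ h _ := vP x xs in h).
pose I a := [set ga | J a <= f ga < v (J a)].
have Idisj a x ga : x < a -> a < si -> I x ga -> I a ga -> False.
  move=> xa /JP[_ /(_ x xa) vJ] /andP[_ h1] /andP[h2 _].
  by have := lt_le_trans (lt_trans h1 vJ) h2; rewrite ltxx.
have hh ga : exists a, a < th /\ forall x, x < th -> I x ga -> a = x.
  case: (pselect (exists a, a < th /\ I a ga)) => [[a [at' Ia]]|ne]; last first.
    by exists \bot; split => [|x xt Ix]; [exact: lt.1|case: ne; exists x].
  exists a; split => // x xt Ix; case: (ltgtP a x) => // ax; exfalso.
    exact: Idisj ax (lt_le_trans xt ts) Ia Ix.
  exact: Idisj ax (lt_le_trans at' ts) Ix Ia.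
have [h hP] := choice hh; exists h; split => [ga|i it]; first exact: (hP ga).1.
have [i1 i2] := olim_succ lt it.
have [Js _] := JP _ (lt_le_trans i2 ts).
have [_ _ pI] := vP _ Js; apply: pos_sub pI => ga Ig /=.
by rewrite ((hP ga).2 _ i2 Ig).
Qed.

End Null.

(** [ep] is an upper bound for the lambda function of walks, where sets accumulating at [de] are
    left out. *)
Definition good (e : O -> set O) de ep ga := forall y, tr e de ga y -> de < y -> ~ cofin (e y) de ->
  forall z, e y z -> z < de -> z <= ep.

Lemma good_mono e de ep ep' ga : ep <= ep' -> good e de ep ga -> good e de ep' ga.
Proof. by move=> ee g y ty dy ny z ez zd; apply: le_trans ee; exact: g ty dy ny z ez zd. Qed.

Lemma ex_good e de ga : cseq e -> olim de -> exists2 ep, ep < de & good e de ep ga.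
Proof.
move=> eP ld.
have hk y : exists k, k < de /\ (~ cofin (e y) de -> forall z, e y z -> z < de -> z <= k).
  case: (pselect (cofin (e y) de)) => [c|/not_cofin[k kd hk]]; last by exists k.
  by exists \bot; split => //; exact: ld.1.
have [k kP] := choice hk.
have [ep ed hep] := @bounded_img de _ [set y | tr e de ga y] k ld
  (finite_small ld (tr_finite eP de ga)) (fun y _ => (kP y).1).
exists ep => // y ty dy ny z ez zd.
exact: le_trans ((kP y).2 ny z ez zd) (ltW (hep y ty)).
Qed.

Lemma U_pos_not_good la ka rho e E th de : succ_singular la ka -> cseq e -> regular rho ->
  cf la < rho -> rho < la -> olim th -> olim de -> de < ka -> th <= cf de ->
  cf de <> cf la -> cf de <> rho ->
  (forall ep, ep < de -> pos la ka rho e E [set ga | ~ good e de ep ga]) ->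
  U_principle ka ka th (cf la).
Proof.
move=> H eP rr mur rl lt ld dk td dm dr hp.
have [k [kd km kc]] := cf_cofinal ld.
have hf ga : exists x, x < cf de /\ good e de (k x) ga.
  have [ep ed gep] := ex_good ga eP ld; have [x xc ex] := kc ep ed.
  by exists x; split => //; apply: good_mono gep; exact: ltW.
pose f ga := least [set x | x < cf de /\ good e de (k x) ga].
have fP ga : f ga < cf de /\ good e de (k (f ga)) ga.
  by have [x hx] := hf ga; exact: (@least_mem [set x | x < cf de /\ good e de (k x) ga] x hx).
have [|h [hth hpos]] := pos_split (E := E) (e := e) H mur (cf_regular ld) (cf_lt_la H dk) dm dr lt td (fun ga => (fP ga).1).
  move=> x xc; refine (pos_sub _ (hp _ (kd x xc))) => ga ng /=; rewrite leNgt; apply/negP => fx.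
  by apply: ng; exact: good_mono (km _ _ (ltW fx) xc) (fP ga).2.
exact: (pos_U (E := E) H eP rr mur rl lt hth hpos).
Qed.

(** Two elements of [e y] inject into [cf y], so one of the images is positive and [cf y] exceeds
    it. *)
Lemma cofin_lim (e : O -> set O) y de : cseq e -> \bot < de -> cofin (e y) de -> olim y.
Proof.
move=> eP d0 ce; have [_ _ _ /(card_leE \bot)[f [fc fi]]] := eP y.
have [u [eu _ ud]] := ce _ d0; have [w [ew uw _]] := ce _ ud.
have [fu fw] := (fc u eu, fc w ew).
have hpos v : f v < cf y -> \bot < f v -> olim y by move=> fv f0; exact: cf_gt_lim f0 fv.
case: (eqVneq (f u) \bot) => [fu0|/neq_bot_gt]; last exact: hpos.
case: (eqVneq (f w) \bot) => [fw0|/neq_bot_gt]; last exact: hpos.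
by exfalso; move: uw; rewrite (fi u w eu ew _) ?ltxx // fu0 fw0.
Qed.

Lemma U_not_Refl la ka th : succ_singular la ka -> regular th -> omega < th -> th < la ->
  ~ Refl ka (cf la) (below ka) -> U_principle ka ka th (cf la).
Proof.
move=> H rt ot tl nR; have [lt ct] := rt.
have [cl il ll cll] := la_props H; have lk := ka_lim H; have uk := ka_unc H.
have io : infinite_set (below (omega : O)) by exact: (@least_mem [set a | infinite_set (below a)] la).
have uth y : th <= cf y -> uncountable_cf y.
  by move=> ty; apply: (uncountable_cfP io); exact: lt_le_trans ty.
case: (pselect (forall T, stationary ka T ->
    stationary ka [set y | [/\ y < ka, th <= cf y & stationary y T]])) => [R|]; last first.
  (* Intersected with the club [C], [T] reflects at no point of cofinality at least [th]: points
     outside [C] are not limits of [C]. *)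
  move=> /existsNP[T /not_implyP[sT /not_stationary[C cC hC]]].
  apply: (U_nonreflecting H rt (lt_trans tl (la_ka H)) (stationary_club uk sT cC)) => y yk ty sy.
  have ly := lim_of_cf lt ty.
  case: (pselect (C y)) => Cy.
    by apply: (hC y Cy); split => //; apply: stationary_sub sy => x [].
  have : ~ cofin C y.
    by move=> cy; apply: Cy; have /clubP[_ _ Cc] := cC; apply: Cc => //; exact: ly.1.
  move=> /not_cofin[ep epy hep]; have [x [[ex xy] [Cx _]]] := sy _ (club_above ly epy).
  by have := hep x Cx xy; rewrite leNgt ex.
move: nR => /existsNP[F /not_implyP[hF /not_implyP[[cF1 cF2] nF]]].
have {}nF y : y < ka -> omega < cf y -> exists2 T, F T & ~ stationary y T.
  move=> yk oy; apply: contrapT => ne; apply: nF; exists y; split => // T FT.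
  apply: contrapT => nT; apply: ne; exists T => // sT; apply: nT => C cC.
  by have [x [Cx Tx]] := sT C cC; exists x; split => //; split => //; have [Cs _ _] := cC; exact: Cs.
have [T0 FT0] : exists T, F T.
  have [y [_ _ yk oy]] := point_cf_gt H (lt_trans ot tl) (club_below lk) lk.1.
  by have [T FT _] := nF y yk oy; exists T.
have [L [mL Ll rL]] := next_regular' H cll; have [rho [Lr rl rr]] := next_regular' H Ll.
have mur := lt_trans mL Lr.
have hX T : exists X, F T -> exists s, [/\ stationary ka X, th <= s /\ s < la, regular s,
      s <> cf la /\ s <> rho & (forall y, X y -> y < ka /\ cf y = s) /\
      forall al, uncountable_cf al -> stationary al X -> stationary al T].
  case: (pselect (F T)) => [/hF[_ sT]|]; last by exists set0.
  by have [s [X hsX]] := ex_lift_avoid H lt uth R (cf la) rho sT; exists X => _; exists s.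
have [X XP] := choice hX.
(* At uncountable cofinality some [T] does not reflect, hence neither does its lift. Otherwise a
   club of [y] has no limit ordinals of uncountable cofinality, and the lift of [T0] consists of
   such points. *)
have hI y : exists p : set O * set O, olim y -> club y p.2 /\
    (y < ka -> F p.1 /\ forall x, p.2 x -> ~ X p.1 x).
  case: (pselect (olim y /\ y < ka)) => [[ly yk]|ne]; last first.
    by exists (set0, below y) => ly; split => [|yk]; [exact: club_below|case: ne].
  case: (ltP omega (cf y)) => oy.
    have [T FT nT] := nF y yk oy; have [s [_ _ _ _ [_ hd]]] := XP T FT.
    have [|C cC hC] := @not_stationary y (X T).
      by move=> sX; apply: nT; apply: hd => //; exact: uncountable_cfP io oy.
    by exists (T, C).
  have [D cD hD] := small_cf_club ly; exists (T0, D) => _; split => // _; split => // x Dx Xx.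
  have [s [_ [ts _] [ls _] _ [/(_ x Xx)[xk cx] _]]] := XP T0 FT0.
  have lx : olim x by apply: (lim_of_cf lt); rewrite cx.
  have := lt_le_trans (hD x Dx lx) oy; rewrite cx => so.
  by have := lt_trans (lt_le_trans ot ts) so; rewrite ltxx.
have [I IP] := choice hI.
have [e [eP eC]] := ex_cseq (fun y ly => (IP y ly).1).
have [E cE pE] := guess H eP rr mur rl rL mL Lr.
case: (pselect (exists T de, [/\ F T, X T de &
    forall ep, ep < de -> pos la ka rho e E [set ga | ~ good e de ep ga]])) => [[T [de [FT Xde hp]]]|npos].
  have [s [_ [ts sl] rs [sm sr] [/(_ de Xde)[dk cd] _]]] := XP T FT.
  have td : th <= cf de by rewrite cd.
  by apply: (U_pos_not_good H eP rr mur rl lt (lim_of_cf lt td) dk td _ _ hp); rewrite cd.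
have hep T de : exists ep, F T -> X T de -> ep < de /\ null la ka rho e E [set ga | ~ good e de ep ga].
  case: (pselect (F T /\ X T de)) => [[FT Xde]|ne]; last by exists \bot => FT Xde; case: ne.
  apply: contrapT => ne; apply: npos; exists T, de; split => // ep ed.
  by apply: contrapT => /not_pos np; apply: ne; exists ep.
(* Thresholds are now bounded up to a null set at each [de]; pressing down makes the bound constant
   on a stationary set. *)
have hY T : exists q : O * set O, F T -> [/\ q.1 < ka, stationary ka q.2 & forall de, q.2 de ->
    q.1 < de /\ de < ka /\ X T de /\ null la ka rho e E [set ga | ~ good e de q.1 ga]].
  case: (pselect (F T)) => [FT|]; last by exists (\bot, set0).
  have [s [sX _ _ _ [hXk _]]] := XP T FT.
  have [f fP] := choice (hep T).
  have [ep ek sS] := fodor uk (cf_ka H) sX (fun x Xx _ => (fP x FT Xx).1).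
  eexists (ep, _) => _; split; [exact: ek|exact: sS|].
  move=> de [Xde <-]; have [h1 h2] := fP de FT Xde; have [h3 _] := hXk de Xde; by [].
have [q qP] := choice hY.
have [si [rsi sil regsi]] := next_regular' H rl.
have sF : small ka F.
  by apply: (small_card_le lk) cF1; rewrite (cf_ka H); exact: lt_trans cll (la_ka H).
have cA T : F T -> club ka [set g | [/\ \bot < g, g < ka & cofin (q T).2 g]].
  by move=> /qP[_ sT _]; apply: club_acc => // x xk; exact: stationary_unbounded uk sT xk.
have sik : si < cf ka by rewrite (cf_ka H); exact: lt_trans sil (la_ka H).
(* A common limit of all these stationary sets; its cofinality [si] differs from [cf la] and [rho],
   as [null_chain] asks. *)
have [ds [[_ hds] d0 dk cd]] := club_cof_point lk regsi sik (club_bigcap uk sF cA) lk.1.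
have ld : olim ds by apply: (cf_gt_lim (x := rho)); [exact: rr.1.1|rewrite cd].
have [k [kd km kc]] := cf_cofinal ld; rewrite cd in kd km kc.
have hdl T : exists r : O -> O, F T -> forall s, s < si -> [/\ (q T).2 (r s), k s < r s & r s < ds].
  case: (pselect (F T)) => [FT|]; last by exists id.
  have hd s : exists r, s < si -> [/\ (q T).2 r, k s < r & r < ds].
    case: (pselect (s < si)) => [ss|]; last by exists \bot.
    by have [_ _ cT] := hds T FT; have [x [? ? ?]] := cT _ (kd s ss); exists x.
  by have [r rP] := choice hd; exists r => _.
have [dl dlP] := choice hdl.
pose W T := [set ga | exists2 x, x < si &
   forall s, x <= s -> s < si -> ~ good e (dl T s) (q T).1 ga].
have nW T : F T -> null la ka rho e E (W T).
  move=> FT; have [_ _ hq] := qP T FT.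
  have sm : si <> cf la by move=> E'; have := lt_trans mur rsi; rewrite E' ltxx.
  have sr : si <> rho by move=> E'; move: rsi; rewrite E' ltxx.
  apply: (null_chain H mur (X := fun x => [set ga | forall s, x <= s -> s < si -> ~ good e (dl T s) (q T).1 ga]) regsi sil sm sr).
    move=> x xs; have [qd _ _] := dlP T FT x xs; have [_ [_ [_ nu]]] := hq _ qd.
    by apply: null_sub nu => ga /(_ x (lexx x) xs).
  by move=> x y xy ys ga hx s ys'; apply: hx; exact: le_trans ys'.
(* The union of the [W T] is null by [null_bigcup], so a guessed point above [ds] escapes all of
   them. *)
have [ga [dga gk nga]] : exists ga, [/\ ds < ga, ga < ka & forall T, F T -> ~ W T ga].
  apply: contrapT => ne.
  have [C cC hC] := null_bigcup H mur cF1 cF2 nW.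
  have [de [[Cde _] dek cde hde]] := pE _ (club_setI uk cC (club_above lk dk)).
  have [p [p1 p2 hp]] := hC de Cde dek cde.
  have [nu [ga [n1 rg [[Cg [dg gk]] _] gd ng]]] := hde _ _ p1 p2.
  apply: (hp nu ga n1 rg Cg _ gd ng); apply: contrapT => nT; apply: ne; exists ga; split => // T FT WT.
  by apply: nT; exists T.
have [D [ep [epd hD Dg hD']]] := walk eP ld dga.
have ceD : cofin (e D) ds.
  case: hD' => [->|[//]]; have [es eu _ _] := eP ds => x /(olim_succ ld)[x1 x2].
  by have [z ez xz] := eu _ x2; exists z; split => //; [exact: lt_le_trans xz|exact: es].
have dD : ds <= D by case: hD' => [->//|[/ltW]].
have lD := cofin_lim eP ld.1 ceD; have Dk := le_lt_trans Dg gk.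
have [cI /(_ Dk)[FT hXT]] := IP D lD; set T := (I D).1 in FT hXT.
have [_ _ hq] := qP T FT.
have hs x : x < si -> exists s, [/\ x <= s, s < si & good e (dl T s) (q T).1 ga].
  move=> xs; apply: contrapT => ne; apply: (nga T FT); exists x => // s sx ss gs.
  by apply: ne; exists s.
(* Close to [ds], the walk from [ga] to [dl T s] passes through [D]. As [e D] avoids [X T], it does
   not accumulate at [dl T s], and goodness bounds [z] by the common threshold. *)
have hle z : e D z -> z < ds -> z <= (q T).1.
  move=> ez zd.
  have zd' : Order.max z ep < ds by rewrite gt_max zd epd.
  have [x xs] := kc _ zd'; rewrite gt_max => /andP[zx ex].
  have [s [xles ss gs]] := hs x xs; have [qd kds dds] := dlP T FT s ss.
  have kk : k x < dl T s by apply: le_lt_trans kds; exact: km.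
  have [_ [_ [Xd _]]] := hq _ qd.
  apply: (gs D) => //.
  - by apply: hD => //; exact: lt_trans kk.
  - exact: lt_le_trans dD.
  - move=> cd'; have [_ _ ec _] := eP D.
    apply: (hXT (dl T s)) Xd; apply: (eC D lD); apply: ec => //.
      exact: le_lt_trans (bot_le _) kk.
    exact: lt_le_trans dD.
  - exact: lt_trans kk.
have [s [_ ss _]] := hs _ regsi.1.1; have [qd _ dds] := dlP T FT s ss.
have [qd' _] := hq _ qd.
have [z [ez qz zd]] := ceD _ (lt_trans qd' dds).
by have := hle z ez zd; rewrite leNgt qz.
Qed.

End Ordinals.

(** * Reduction to [cf theta] and the six cases *)

Theorem theoremB (d : Order.disp_t) (O : bOrderType d)
    (wfO : well_order (@Order.le d O))
    (lambda kappa theta : O)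
    (lambda_singular : singular lambda)
    (kappa_succ : is_succ_cardinal lambda kappa)
    (theta_card : is_cardinal theta)
    (theta_inf : infinite_set (below theta))
    (theta_le : theta <= lambda)
    (hyp :
      (* 2^lambda = lambda^+ *)
      ([set X : set O | X `<=` below lambda] #= below kappa) \/
      ~ Refl kappa (cf lambda) (below kappa) \/
      (exists c : O -> O -> O,
         closed_coloring kappa theta c /\
         U_witness kappa (ord_of_nat 2) theta (ord_of_nat 2) c) \/
      (* the second conjunct is 2^cf(lambda) < lambda *)
      (cf theta < cf lambda /\
         card_lt [set X : set O | X `<=` below (cf lambda)] (below lambda)) \/
      cf theta = cf lambda \/
      cf theta = omega) :
  U_principle kappa kappa theta (cf lambda).
Proof.
have H : succ_singular lambda kappa by [].
have lt : olim theta := infinite_cardinal_lim theta_card theta_inf.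
have [cl il ll cll] := la_props H.
have rt := cf_regular wfO lt; have ct := cf_lim wfO lt.
(* [cf theta] is regular and [lambda] is singular, so they differ. *)
have tl : cf theta < lambda.
  rewrite lt_neqAle (le_trans (cf_le wfO theta) theta_le) andbT; apply/eqP => E.
  by move: cll; rewrite -E (cf_cf wfO lt) ltxx.
have [c1|[c2|[[c [clo wc]]|[[c4 p4]|[c5|c6]]]]] := hyp.
- exact: (U_gch wfO H lt theta_le c1).
(* The argument from failure of reflection is for [cf theta > omega]; the remaining value is covered
   by walk lengths. *)
- apply: (U_lift_cf wfO lt); have oc : omega <= cf theta.
    by apply: (least_le wfO); exact: (lim_infinite wfO ct).
  move: oc; rewrite le_eqVlt => /orP[/eqP oc|oc]; last exact: (U_not_Refl wfO H rt oc tl c2).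
  by rewrite -oc; apply: (U_omega wfO H); rewrite oc.
- exact: (U_closed wfO H lt clo wc).
- exact: (U_lift_cf wfO lt (U_small_power wfO H ct c4 p4)).
- by apply: (U_lift_cf wfO lt); rewrite c5; exact: (U_cf_la wfO H).
- by apply: (U_lift_cf wfO lt); rewrite c6; apply: (U_omega wfO H); rewrite -c6.
Qed.
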